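(* Let $A$ and $B$ be spherical subword complexes of finite type. Then every graph isomorphism $f: FR(A)\to FR(B)$ between their facet-ridge graphs has a unique extension to a simplicial isomorphism $g: A\to B$ (that is, there is exactly one simplicial isomorphism $g:A\to B$ with $g(F)=f(F)$ for every facet $F$ of $A$).
   Context: A simplicial complex $\Delta$ on a finite set $V$ is a set of subsets of $V$ (faces) closed under taking subsets; facets are the inclusion-maximal faces; vertices are the elements $v$ with $\{v\}\in\Delta$; ridges are the faces consisting of all but one vertex of a facet. The facet-ridge graph $FR(\Delta)$ has as vertices the facets of $\Delta$ and as edges the pairs of distinct facets that both contain a common ridge of both facets. A simplicial isomorphism $A\to B$ is an inclusion-preserving bijection between faces induced by a bijection of the vertices (elements of the ground set that are not vertices are ignored). Let $(W,S)$ be a Coxeter system with $S$ finite and length function $\ell$. For a word $Q=(q_1,\dots,q_r)$ in $S$ and $J\subseteq[r]=\{1,\dots,r\}$, $Q_J$ denotes the subword of letters in positions in $J$. For $\pi\in W$, the subword complex $\mathcal{S}(Q,\pi)$ is the simplicial complex on $[r]$ whose facets are the subsets $I\subseteq[r]$ such that $Q_{[r]\setminus I}$ is a reduced expression for $\pi$. It is of finite type if $W$ is finite. It is spherical if its geometric realization is homeomorphic to a sphere (the complex $\{\emptyset\}$ counts as the $(-1)$-dimensional sphere); for a non-empty subword complex this is equivalent to $\operatorname{Dem}(Q)=\pi$, where the Demazure product is defined by $\operatorname{Dem}(\text{empty word})=e$ and, for $Q'$ obtained from $Q$ by appending $s\in S$, with $\mu=\operatorname{Dem}(Q)$: $\operatorname{Dem}(Q')=\mu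 s$ if $\ell(\mu s)>\ell(\mu)$ and $\operatorname{Dem}(Q')=\mu$ if $\ell(\mu s)<\ell(\mu)$. The complexes $A$ and $B$ may come from different Coxeter systems. *)

(* Defs.v *)
From HB Require Import structures.
From mathcomp Require Import all_boot all_order all_algebra all_fingroup.
From mathcomp Require Import boolp classical_sets reals topology.
From mathcomp Require Import normedtype.

Set Implicit Arguments.
Unset Strict Implicit.
Unset Printing Implicit Defensive.

Import Order.TTheory GRing.Theory Num.Theory.
Import numFieldNormedType.Exports.

Local Open Scope set_scope.

(* The complex without any face (the void complex) is allowed; it differs from
   the complex whose only face is the empty set. *)
Record complex (V : finType) := Complex {
  faces : {set {set V}};
  faces_closed : forall F G : {set V}, F \subset G -> G \in faces -> F \in faces
}.

Section Complexes.
Variables (V : finType) (D : complex V).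

Definition facets : {set {set V}} := [set F | maxset [in faces D] F].

Definition vertices : {set V} := [set v | [set v] \in faces D].

Definition face := {F : {set V} | F \in faces D}.
Definition facet := {F : {set V} | F \in facets}.
Definition vertex := {v : V | v \in vertices}.

Lemma facets_faces (F : {set V}) : F \in facets -> F \in faces D.
Proof. by rewrite inE => /maxsetp. Qed.

Definition facet_face (F : facet) : face :=
  exist _ (val F) (facets_faces (valP F)).

Definition ridge_of (F R : {set V}) : bool := [exists v in F, R == F :\ v].

Definition FR : rel facet := fun F G =>
  (F != G) && [exists R : {set V}, ridge_of (val F) R && ridge_of (val G) R].

End Complexes.

Section Isomorphisms.
Variables (V V' : finType) (A : complex V) (B : complex V').

Definition FR_isomorphism (f : facet A -> facet B) : Prop :=
  bijective f /\ forall F G : facet A, FR (f F) (f G) = FR F G.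

(* Since phi lives on the vertices only, the elements of V and V' that are not
   vertices play no role. *)
Definition simplicial_isomorphism (g : face A -> face B) : Prop :=
  [/\ bijective g,
      forall F G : face A, val F \subset val G -> val (g F) \subset val (g G) &
      exists2 phi : vertex A -> vertex B, bijective phi &
        forall F : face A,
          val (g F) = [set val (phi v) | v : vertex A & val v \in val F]].

Definition extends_facet_map (f : facet A -> facet B) (g : face A -> face B)
    : Prop :=
  forall F : facet A, val (g (facet_face F)) = val (f F).

End Isomorphisms.

Section Subwords.
Local Open Scope group_scope.

(* W is presented by the generators s in S and the relations
   (s t)^m(s,t) = 1, where m(s,t) is the order of s t. The relations s^2 = 1 are
   the case s = t. The presentation is expressed by its universal property, in
   which H is an arbitrary, possibly infinite, group. *)
Definition coxeter_system (W : finGroupType) (S : {set W}) : Prop :=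
  [/\ <<S>> = [set: W],
      {in S, forall s, #[s] = 2} &
      forall (H : groupType) (f : W -> H),
        {in S &, forall s t, (f s * f t) ^+ #[s * t] = 1} ->
        exists2 h : W -> H, {morph h : x y / x * y} & {in S, h =1 f}].

Definition expression (W : finGroupType) (S : {set W}) (w : seq W) (x : W)
    : Prop :=
  {subset w <= S} /\ \prod_(s <- w) s = x.

Definition reduced_expression (W : finGroupType) (S : {set W}) (w : seq W)
    (x : W) : Prop :=
  expression S w x /\
  forall w' : seq W, expression S w' x -> size w <= size w'.

Definition subword (W : finGroupType) (r : nat) (Q : r.-tuple W)
    (J : {set 'I_r}) : seq W := [seq tnth Q i | i <- enum J].

Section SubwordComplex.
Variables (W : finGroupType) (S : {set W}) (r : nat) (Q : r.-tuple W) (x : W).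

Definition subword_faces : {set {set 'I_r}} :=
  [set F : {set 'I_r} | [exists I : {set 'I_r},
     (F \subset I) && `[< reduced_expression S (subword Q (~: I)) x >]]].

Lemma subword_faces_closed (F G : {set 'I_r}) :
  F \subset G -> G \in subword_faces -> F \in subword_faces.
Proof.
move=> FG; rewrite !inE => /existsP[I /andP[GI rI]].
by apply/existsP; exists I; rewrite (fintype.subset_trans FG GI).
Qed.

Definition subword_complex : complex 'I_r := Complex subword_faces_closed.

Lemma facets_subword_complex (F : {set 'I_r}) :
  F \in facets subword_complex <-> reduced_expression S (subword Q (~: F)) x.
Proof.
have sz J : size (subword Q J) = #|J| by rewrite size_map -cardE.
rewrite inE; split=> [/maxsetP[/= + maxF] | redF].
  rewrite inE => /existsP[I /andP[FI rI]].
  rewrite -(maxF I) //; first exact/asboolP.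
  by rewrite inE; apply/existsP; exists I; rewrite subxx.
apply/maxsetP; split=> [|G]; rewrite inE.
  by apply/existsP; exists F; rewrite subxx; apply/asboolP.
move=> /existsP[I /andP[GI /asboolP[eI _]]] FG.
apply/eqP; rewrite eq_sym eqEcard FG /=.
have := redF.2 _ eI; rewrite !sz => cFI.
apply: leq_trans (subset_leq_card GI) _.
by rewrite -(leq_add2r #|~: F|) cardsC -(cardsC I) leq_add2l.
Qed.

End SubwordComplex.
End Subwords.

Section Spheres.
Local Open Scope ring_scope.

Definition homeomorphic (X Y : ptopologicalType) (A : set X) (B : set Y)
    : Prop :=
  exists f : X -> Y, exists g : Y -> X,
    [/\ {within A, continuous f}%classic,
        {within B, continuous g}%classic,
        forall x, A x -> B (f x) /\ g (f x) = x &
        forall y, B y -> A (g y) /\ f (g y) = y].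

Definition geometric_realization (R : realType) (V : finType) (D : complex V)
    : set 'rV[R]_#|V| :=
  fun x => [/\ forall i, 0 <= x 0 i, \sum_i x 0 i = 1 &
               [set v : V | x 0 (enum_rank v) != 0] \in faces D].

(* The sphere of dimension n - 1; it is empty for n = 0. *)
Definition unit_sphere (R : realType) (n : nat) : set 'rV[R]_n :=
  fun x => \sum_i x 0 i ^+ 2 = 1.

(* The complex whose only face is set0 is spherical (n = 0). The void complex,
   which has the same empty geometric realization, is excluded. *)
Definition spherical (R : realType) (V : finType) (D : complex V) : Prop :=
  finset.set0 \in faces D /\
  exists n : nat, homeomorphic (@geometric_realization R V D)
                               (@unit_sphere R n).

End Spheres.

(* Main.v *)
Require Import Defs.
From mathcomp Require Import all_boot all_order all_algebra all_fingroup.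
From mathcomp Require Import reals boolp.
From mathcomp Require Import zify.

Set Implicit Arguments.
Unset Strict Implicit.
Unset Printing Implicit Defensive.

(** The argument transports to subword complexes Kalai's proof that the graph
    of a simple polytope determines its face lattice; acyclic orientations by
    generic linear functionals are replaced by shellings.

    Let D be a pure complex in which every ridge lies in exactly two facets,
    and rank the facets of D injectively. Each facet F has one neighbor for
    each of its vertices v, the one obtained by removing v, and all other
    neighbors of F stay in the star of v. So F is a local minimum of the star
    of v exactly when no neighbor of F ranks lower except possibly that one.
    Such pairs of adjacent facets (source_pairs) are defined by the graph and
    the ranking alone, and since every star has a global minimum there are at
    least as many of them as vertices, with equality when no star has a second
    local minimum. A shelling order is a ranking with equality. Given a graph
    isomorphism f from A to B, comparing the two counts in both directions
    shows that A and B have equally many vertices and that f carries a ranking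
    with equality to one with equality. Now let the star of v come last in a
    shelling of A, with minimum F. The vertex w of f F removed on the way to
    the image of the neighbor of F across v has a star with minimum f F, which
    therefore lies in the image of the star of v; both stars are connected and
    miss exactly one neighbor of each of their facets, so they correspond
    (star_image). Stars determine vertices, and the resulting vertex map is the
    only possible extension (FR_isomorphism_extends).

    It remains to find, for each position k of the word, a shelling of the
    spherical subword complex in which the star of k comes last. Order the
    positions cyclically as k, k - 1, ..., 1, r, ..., k + 1; of two facets the
    later one is the one that contains the first position at which they differ.
    Attach to a position p and a set J of positions the reflection that inserts
    or deletes the letter at p in the subword on J. Distinct letters of a
    reduced subword have distinct reflections, and flipping p in a facet
    exchanges it for the letter with the same reflection; if F precedes G and p
    is their first difference, the flip of p in G cannot go up, since F would
    otherwise contain in its reduced complement two letters with the same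
    reflection (facet_flip_down). The strong exchange property used here
    follows from the presentation of the Coxeter group, through its action on
    signed elements.

    Flips exist at every element of every facet when the Demazure product of
    the word is pi, because it dominates all subword products in Bruhat order.
    This is where sphericity enters (spherical_demazure): if the Demazure
    product differs from pi, induction on the length of the word, through the
    deletion and the link of the last position, collapses the full simplex on
    the positions onto the complex. Elementary collapses are realized by
    retractions, and a retract K of a simplex is not homeomorphic to a sphere:
    a homeomorphism from the sphere to K would extend over the cube with values
    in the simplex, and retracting and mapping back would give a map from the
    cube to the sphere which is radial on the boundary of the cube, contrary to
    the Poincare-Miranda theorem. That theorem follows by compactness from a
    parity statement about labelings of a cubical grid, which is Stokes'
    formula for a cup product of mod 2 coboundaries. *)

(** * Length, exchange and Bruhat order in a finite Coxeter group *)

Section Length.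
Local Open Scope group_scope.
Variables (W : finGroupType) (S : {set W}).

Definition len (x : W) : nat :=
  if pselect (exists n, `[< exists2 w, expression S w x & size w = n >])
    is left h then ex_minn h else 0.

Hypothesis cox : coxeter_system S.

Lemma expression_exists x : exists w, expression S w x.
Proof.
case: cox => gS _ _; have: x \in <<S>> by rewrite gS inE.
case/gen_prodgP => n [c cS ->]; exists [seq c i | i <- enum 'I_n]; split.
  by move=> _ /mapP[i _ ->].
by rewrite big_map enumT [index_enum _]unlock.
Qed.

Lemma lenP x :
  (exists2 w, expression S w x & size w = len x) /\
  (forall w, expression S w x -> len x <= size w).
Proof.
rewrite /len; case: pselect => [h|[]]; last first.
  by have [w ew] := expression_exists x; exists (size w); apply/asboolP;
    exists w.
case: ex_minnP => n /asboolP[w ew sw] minn; split; first by exists w.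
by move=> w' ew'; apply: minn; apply/asboolP; exists w'.
Qed.

Lemma reduced_lenP w x :
  reduced_expression S w x <-> expression S w x /\ size w = len x.
Proof.
have [[v ev sv] minx] := lenP x; split=> [[ew minw]|[ew sw]]; split=> //.
  by apply/eqP; rewrite eqn_leq minx // -sv minw.
by move=> w' ew'; rewrite sw minx.
Qed.

Lemma generator_mulxx s : s \in S -> s * s = 1.
Proof. by case: cox => _ oS _ sS; rewrite -[s * s]/(s ^+ 2) -(oS _ sS)
  expg_order. Qed.

Lemma generator_inv s : s \in S -> s^-1 = s.
Proof. by move=> sS; apply/eqP; rewrite eq_invg_mul generator_mulxx. Qed.

Lemma len_mulr x s : s \in S -> len (x * s) <= (len x).+1.
Proof.
move=> sS; have [[w [wS wx] <-] _] := lenP x.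
rewrite -(size_rcons w s); apply: (lenP _).2; split.
  by move=> y; rewrite mem_rcons inE => /predU1P[->//|/wS].
by rewrite -cats1 big_cat /= big_seq1 wx.
Qed.

Lemma len_mulrV x s : s \in S -> len x <= (len (x * s)).+1.
Proof.
by move=> sS; rewrite -{1}[x]mulg1 -(generator_mulxx sS) mulgA len_mulr.
Qed.

(** Bourbaki's action: a generator s conjugates an element t and flips its sign
    when t = s, so that a word flips the sign of t once for each of its letters
    whose reflection is t. *)
Definition signed_conj (s : W) (tb : W * bool) : W * bool :=
  (tb.1 ^ s, tb.2 (+) (tb.1 == s)).

Lemma signed_conj_inj s : injective (signed_conj s).
Proof.
by move=> [t b] [t' b'] [/conjg_inj -> /addIb ->].
Qed.

Definition signed_perm s := perm (@signed_conj_inj s).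


Lemma braid_conj s t i : s \in S -> t \in S ->
  s * (s * t) ^- i = (s * t) ^+ i * s.
Proof.
move=> sS tS; apply: (mulIg ((s * t) ^+ i)); rewrite mulgKV.
elim: i => [|i IH]; first by rewrite mul1g mulg1.
rewrite {2}expgS expgSr -!mulgA (mulgA s s) generator_mulxx // mul1g.
by rewrite (mulgA t t) generator_mulxx // mul1g !mulgA.
Qed.


(** The 2k letters of (st)^k have the reflections (st)^i s for i < 2k. *)
Lemma signed_perm_pow s t k u b : s \in S -> t \in S ->
  ((signed_perm s * signed_perm t) ^+ k) (u, b) =
  (u ^ ((s * t) ^+ k),
   b (+) \big[addb/false]_(0 <= i < k.*2) (u == (s * t) ^+ i * s)).
Proof.
move=> sS tS; have sV := generator_inv sS.
have conjE (v x y : W) : (v ^ x == y) = (v == y ^ x^-1).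
  by rewrite -(inj_eq (@conjg_inj _ x^-1)) conjgK.
elim: k => [|k IH]; first by rewrite !expg0 perm1 conjg1 big_geq // addbF.
rewrite expgSr permM {}IH permM !permE /signed_conj /= doubleS.
rewrite !big_nat_recr //= -!conjgM -expgSr !addbA !conjE.
have -> : s ^ (s * t) ^- k = (s * t) ^+ k.*2 * s.
  by rewrite conjgE invgK braid_conj // mulgA -expgD addnn.
have -> : t ^ ((s * t) ^+ k * s)^-1 = (s * t) ^+ k.*2.+1 * s.
  rewrite conjgE invgK invMg sV braid_conj //.
  by rewrite -addnn -addSn expgD expgSr !mulgA.
by [].
Qed.

(** When k is the order m of st, the reflections for i and i + m agree, so each
    sign is flipped an even number of times: the signed permutations satisfy
    the defining relations. *)
Lemma signed_perm_order s t : s \in S -> t \in S ->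
  (signed_perm s * signed_perm t) ^+ #[s * t] = 1.
Proof.
move=> sS tS; apply/permP=> -[u b]; rewrite signed_perm_pow // perm1.
rewrite expg_order conjg1 -addnn (big_cat_nat (leq0n _) (leq_addr _ _)) /=.
rewrite -{2}[#[_]]add0n big_addn addnK.
have -> : \big[addb/false]_(0 <= i < #[s * t])
    (u == (s * t) ^+ (i + #[s * t]) * s) =
  \big[addb/false]_(0 <= i < #[s * t]) (u == (s * t) ^+ i * s).
  by apply: eq_bigr => i _; rewrite expgD expg_order mulg1.
by rewrite addbb addbF.
Qed.

(** The parity of the number of letters of w whose reflection is t. *)
Fixpoint inversion_parity (w : seq W) (t : W) : bool :=
  if w is s :: w' then (t == s) (+) inversion_parity w' (t ^ s) else false.

Lemma inversion_parity_cat w w' t :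
  inversion_parity (w ++ w') t =
  inversion_parity w t (+) inversion_parity w' (t ^ \prod_(s <- w) s).
Proof.
elim: w t => [|s w IH] t /=; first by rewrite big_nil conjg1.
by rewrite IH big_cons conjgM addbA.
Qed.

(** By the universal property the signed permutation of a word depends only on
    its product. *)
Lemma inversion_parity_prod w w' t : {subset w <= S} -> {subset w' <= S} ->
  \prod_(s <- w) s = \prod_(s <- w') s ->
  inversion_parity w t = inversion_parity w' t.
Proof.
have [_ _ /(_ _ signed_perm signed_perm_order)[h hM hS]] := cox.
have h1 : h 1 = 1 by apply: (mulIg (h 1)); rewrite -hM !mul1g.
have act v : {subset v <= S} -> forall u b,
    h (\prod_(s <- v) s) (u, b) = (u ^ \prod_(s <- v) s, b (+)
      inversion_parity v u).
  elim: v => [|s v IH] vS u b; first by rewrite big_nil h1 perm1 conjg1 addbF.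
  rewrite big_cons hM hS ?vS ?mem_head // permM permE /signed_conj /= IH.
    by rewrite conjgM addbA.
  by move=> y yv; rewrite vS // inE yv orbT.
move=> wS w'S ww'; have := act _ w'S t false.
by rewrite -ww' act // => -[].
Qed.

Lemma inversion_parityP w t : inversion_parity w t ->
  exists w1 s w2, w = w1 ++ s :: w2 /\ t = s ^ (\prod_(u <- w1) u)^-1.
Proof.
elim: w t => [|s w IH] t //=.
have [-> _|_ /IH[w1 [s' [w2 [-> ts]]]]] := eqVneq t s.
  by exists [::], s, w; rewrite big_nil invg1 conjg1.
exists (s :: w1), s', w2; split=> //.
by rewrite big_cons invMg conjgM -ts conjgK.
Qed.

Definition reflection (t : W) := exists2 s, s \in S & exists y, t = s ^ y.

Lemma reflection_mulxx t : reflection t -> t * t = 1.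
Proof. by case=> s sS [y ->]; rewrite -conjMg generator_mulxx // conj1g. Qed.

Lemma delete_letter w1 s w2 : s \in S ->
  s ^ (\prod_(u <- w1) u)^-1 * \prod_(u <- w1 ++ s :: w2) u =
  \prod_(u <- w1 ++ w2) u.
Proof.
move=> sS; rewrite !big_cat big_cons /= conjgE invgK -!mulgA mulKg.
by rewrite (mulgA s s) generator_mulxx // mul1g.
Qed.

Lemma parity_shortens w t : {subset w <= S} -> inversion_parity w t ->
  len (t * \prod_(s <- w) s) < size w.
Proof.
move=> wS /inversion_parityP[w1 [s [w2 [wE tE]]]].
have sS : s \in S by apply: wS; rewrite wE mem_cat inE eqxx orbT.
rewrite tE wE delete_letter // size_cat /= addnS ltnS -size_cat.
apply: (lenP _).2; split=> // y; rewrite mem_cat => yw; apply: wS.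
by rewrite wE mem_cat inE; case/orP: yw => ->; rewrite ?orbT.
Qed.

Lemma rev_expression w x : expression S w x -> expression S (rev w) x^-1.
Proof.
case=> wS <-; split; first by move=> s; rewrite mem_rev => /wS.
elim: w wS => [|s w IH] wS; first by rewrite !big_nil invg1.
rewrite rev_cons -cats1 big_cat /= big_seq1 big_cons invMg IH.
  by rewrite (generator_inv (wS s _)) ?mem_head.
by move=> y yw; rewrite wS // inE yw orbT.
Qed.

(** Writing t as the palindrome v^-1 s v, the letters of v^-1 and of v whose
    reflection is t match up, because v^-1 v acts trivially; the middle s is
    left over. *)
Lemma reflection_parity t w : reflection t -> {subset w <= S} ->
  \prod_(s <- w) s = t -> inversion_parity w t.
Proof.
move=> [s sS [y tE]] wS wt; have [v [vS vy]] := expression_exists y.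
have [rS rvy] : expression S (rev v) y^-1 by exact: rev_expression.
have vrev u : inversion_parity (rev v) u = inversion_parity v (u ^ y^-1).
  have : inversion_parity (rev v ++ v) u = inversion_parity [::] u.
    apply: inversion_parity_prod => //.
      by move=> z; rewrite mem_cat => /orP[/rS|/vS].
    by rewrite big_cat /= vy rvy mulVg big_nil.
  by rewrite inversion_parity_cat rvy /= => /(canRL (addbK _)) ->.
rewrite (@inversion_parity_prod w (rev v ++ s :: v)) //.
- rewrite inversion_parity_cat rvy vrev /= tE conjgK eqxx.
  by rewrite conjgE mulKg; case: inversion_parity.
- by move=> z; rewrite mem_cat inE => /or3P[/rS|/eqP->|/vS].
- by rewrite wt tE big_cat big_cons /= vy rvy conjgE mulgA.
Qed.

(** An odd parity lets a letter of a reduced word be deleted. An even parity at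
    x is an odd one at t x, since t itself has odd parity at t. *)
Lemma parity_len t w x : reflection t -> expression S w x ->
  if inversion_parity w t then len (t * x) < len x else len x < len (t * x).
Proof.
move=> rt [wS wx].
have [[v [vS vx] sv] _] := lenP x.
rewrite (@inversion_parity_prod w v) ?vx //.
case: ifP => [pv|npv]; first by rewrite -{1}vx -sv parity_shortens.
have [[u [uS ut] _] _] := lenP t.
have [[z [zS zx] sz] _] := lenP (t * x).
suff pz : inversion_parity z t.
  rewrite -sz; have := parity_shortens zS pz.
  by rewrite zx mulgA reflection_mulxx // mul1g.
rewrite (@inversion_parity_prod z (u ++ v)) //; last first.
- by rewrite big_cat /= ut vx zx.
- by move=> y; rewrite mem_cat => /orP[/uS|/vS].
rewrite inversion_parity_cat ut conjgE mulKg npv addbF.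
exact: reflection_parity.
Qed.

Lemma len_reflection t x : reflection t -> len (t * x) != len x.
Proof.
move=> rt; have [w ew] := expression_exists x.
have := parity_len rt ew; case: ifP => _ lt; first by rewrite ltn_eqF.
by rewrite gtn_eqF.
Qed.

Lemma strong_exchange t w x : reflection t -> expression S w x ->
  len (t * x) < len x ->
  exists w1 s w2, w = w1 ++ s :: w2 /\ t = s ^ (\prod_(u <- w1) u)^-1.
Proof.
move=> rt ew lt; apply: inversion_parityP; have := parity_len rt ew.
by case: ifP => // _; rewrite ltnNge ltnW.
Qed.


Lemma reflection_generator s y : s \in S -> reflection (s ^ y).
Proof. by exists s => //; exists y. Qed.

Lemma len_mulr_neq x s : s \in S -> len (x * s) != len x.
Proof.
move=> sS; have := len_reflection x (reflection_generator x^-1 sS).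
by rewrite -conjgCV.
Qed.

(** The step is added at the small end, which is the induction that the lifting
    property needs. *)
Inductive bruhat : W -> W -> Prop :=
| bruhat_refl u : bruhat u u
| bruhat_step t u v :
    reflection t -> len u < len (t * u) -> bruhat (t * u) v -> bruhat u v.

Lemma bruhat_len u v : bruhat u v -> u = v \/ len u < len v.
Proof.
elim=> [{}u|t {}u {}v _ lt _ [<-|lt']]; [by left|by right|right].
exact: ltn_trans lt'.
Qed.

Lemma bruhat_trans u v w : bruhat u v -> bruhat v w -> bruhat u w.
Proof. by elim=> // t {}u {}v rt lt _ IH /IH; exact: bruhat_step. Qed.

Lemma bruhat_mulr u s v : s \in S -> len u < len (u * s) ->
  bruhat (u * s) v -> bruhat u v.
Proof.
move=> sS lt b; apply: (@bruhat_step (s ^ u^-1)).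
- exact: reflection_generator.
- by rewrite -conjgCV.
- by rewrite -conjgCV.
Qed.

(** Let u < t u be the first step of a chain from u to v. Either u s < t u s
    and the chain is lifted, or the exchange property applied to a reduced word
    of u followed by s deletes that s (another letter would make t u shorter
    than u), and then u s = t u. *)
Lemma bruhat_lifting u v s : s \in S -> len (v * s) < len v ->
  bruhat u v -> bruhat (u * s) v.
Proof.
move=> sS lts b; elim: b lts => [{}v|t {}u {}v rt lt b IH] lts.
  apply: (@bruhat_mulr _ s) => //; rewrite -mulgA generator_mulxx // mulg1 //.
  exact: bruhat_refl.
have b' := IH lts.
have [lt1|] := ltnP (len (u * s)) (len (t * (u * s))).
  by apply: bruhat_step rt lt1 _; rewrite mulgA.
rewrite leq_eqVlt (negPf (len_reflection _ rt)) /= => lt1.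
have uss : u * s * s = u by rewrite -mulgA generator_mulxx // mulg1.
have [|] := ltnP (len (u * s)) (len u).
  move=> lt2; apply: (@bruhat_mulr _ s); rewrite ?uss //.
  exact: bruhat_step rt lt b.
rewrite leq_eqVlt eq_sym (negPf (len_mulr_neq _ sS)) /= => lt2.
have [[w [wS wu] sw] _] := lenP u.
have ews : expression S (rcons w s) (u * s).
  split; last by rewrite -cats1 big_cat /= big_seq1 wu.
  by move=> y; rewrite mem_rcons inE => /predU1P[->//|/wS].
have [w1 [s' [w2 []]]] := strong_exchange rt ews lt1.
case/lastP: w2 => [|w2 s''].
  rewrite cats1 => /rcons_inj[<- <-] tE.
  by move: b; rewrite tE wu -conjgCV.
rewrite -rcons_cons -rcons_cat => /rcons_inj[wE _] tE.
have s'S : s' \in S by apply: wS; rewrite wE mem_cat inE eqxx orbT.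
suff : len (t * u) < len u by rewrite ltnNge ltnW.
rewrite -sw -wu tE wE delete_letter // size_cat /= addnS ltnS -size_cat.
apply: (lenP _).2; split=> // y; rewrite mem_cat => yw; apply: wS.
by rewrite wE mem_cat inE; case/orP: yw => ->; rewrite ?orbT.
Qed.

Definition demazure_step (x s : W) : W := if len x < len
  (x * s) then x * s else x.

Definition demazure (w : seq W) : W := foldl demazure_step 1 w.

Lemma demazure_rcons w s :
  demazure (rcons w s) = demazure_step (demazure w) s.
Proof. by rewrite /demazure foldl_rcons. Qed.

Lemma bruhat_demazure_step u x s : s \in S -> bruhat u x ->
  bruhat u (demazure_step x s) /\ bruhat (u * s) (demazure_step x s).
Proof.
move=> sS b; rewrite /demazure_step; case: ltnP => [lt|].
  have b' : bruhat u (x * s).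
    by apply: bruhat_trans b _; apply: bruhat_mulr lt (bruhat_refl _).
  split=> //; apply: bruhat_lifting => //.
  by rewrite -mulgA generator_mulxx // mulg1.
rewrite leq_eqVlt (negPf (len_mulr_neq _ sS)) /= => lt; split=> //.
exact: bruhat_lifting.
Qed.

End Length.

(** * Subwords as sets of positions and their reflections *)

Section Positions.
Local Open Scope group_scope.
Variables (W : finGroupType) (S : {set W}) (cox : coxeter_system S).
Variables (r : nat) (Q : r.-tuple W) (QS : {subset Q <= S}).
Implicit Types (I J : {set 'I_r}) (p j : 'I_r).
Local Notation q := (tnth Q).

Definition subprod J : W := \prod_(i <- enum J) q i.

Lemma subprod_subword J : \prod_(s <- subword Q J) s = subprod J.
Proof. by rewrite big_map. Qed.

Lemma letterS i : q i \in S. Proof. by rewrite QS // mem_tnth. Qed.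

Lemma subwordS J : {subset subword Q J <= S}.
Proof. by move=> _ /mapP[i _ ->]; exact: letterS. Qed.

Lemma size_subword J : size (subword Q J) = #|J|.
Proof. by rewrite size_map -cardE. Qed.

Lemma reducedE J x :
  reduced_expression S (subword Q J) x <-> subprod J = x /\ #|J| = len S x.
Proof.
rewrite (reduced_lenP cox) size_subword.
by split=> [[[_ <-]]|[<- eJ]]; do ?split=> //; rewrite ?subprod_subword //;
  exact: subwordS.
Qed.

Lemma len_subprod J : len S (subprod J) <= #|J|.
Proof.
rewrite -size_subword; apply: (lenP cox _).2.
by split; rewrite ?subprod_subword //; exact: subwordS.
Qed.

Definition below_pos J (p : nat) := [set i in J | i < p].
Definition from_pos J (p : nat) := [set i in J | p <= i].

Lemma enum_split J (p : nat) : enum J = enum (below_pos J p) ++ enum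
  (from_pos J p).
Proof.
have -> : enum (below_pos J p) = [seq i <- enum J | val i < p].
  by rewrite /enum_mem -filter_predI; apply: eq_filter => i;
    rewrite /= !inE andbC.
have -> : enum (from_pos J p) = [seq i <- enum J | p <= val i].
  by rewrite /enum_mem -filter_predI; apply: eq_filter => i;
    rewrite /= !inE andbC.
have : sorted (relpre val ltn) (enum J).
  rewrite /enum_mem; apply: sorted_filter; first by move=> ? ? ? /=;
    exact: ltn_trans.
  by rewrite -sorted_map -enumT val_enum_ord iota_ltn_sorted.
elim: (enum J) => //= i s IH.
rewrite path_sortedE; last by move=> ? ? ? /=; exact: ltn_trans.
case/andP=> /allP gti sort_s.
have [ltip|leip] := ltnP; first by rewrite /= -IH.
have E : [seq k <- s | val k < p] = [::].
  apply/eqP; rewrite -size_eq0 size_filter -leqn0 leqNgt -has_count.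
  by apply/hasPn=> k /gti /= ltik; rewrite -leqNgt; lia.
by rewrite E /= {1}IH // E.
Qed.

Lemma subprod_split J (p : nat) : subprod J =
  subprod (below_pos J p) * subprod (from_pos J p).
Proof. by rewrite /subprod (enum_split J p) big_cat. Qed.

Lemma subprod0 : subprod set0 = 1.
Proof. by rewrite /subprod enum_set0 big_nil. Qed.

Lemma subprod1 p : subprod [set p] = q p.
Proof. by rewrite /subprod enum_set1 big_seq1. Qed.

Lemma enum_at J p : p \in J ->
  enum J = enum (below_pos J p) ++ p :: enum (from_pos J p.+1).
Proof.
move=> pJ; rewrite (enum_split J p) (enum_split (from_pos J p) p.+1).
have -> : below_pos (from_pos J p) p.+1 = [set p].
  apply/setP=> i; rewrite !inE ltnS -andbA -eqn_leq eq_sym -val_eqE /=.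
  by rewrite andbC; case: eqP => //= /val_inj ->.
have -> : from_pos (from_pos J p) p.+1 = from_pos J p.+1.
  by apply/setP=> i; rewrite !inE -andbA; congr (_ && _); lia.
by rewrite enum_set1.
Qed.

Lemma subprod_from J p :
  subprod (from_pos J p) = (if p \in J then q p else 1) * subprod
    (from_pos J p.+1).
Proof.
rewrite (subprod_split _ p.+1); congr (_ * subprod _).
  case: ifP => pJ; first rewrite -(subprod1 p); last rewrite -subprod0;
    congr subprod.
    apply/setP=> i; rewrite !inE ltnS -andbA -eqn_leq eq_sym -val_eqE /=.
    by rewrite andbC; case: eqP => //= /val_inj ->.
  apply/setP=> i; rewrite !inE ltnS -andbA -eqn_leq.
  by case: eqP => [/val_inj <-|]; rewrite ?pJ ?andbF.
by apply/setP=> i; rewrite !inE -andbA; congr (_ && _); lia.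
Qed.

(** The reflection whose left multiplication inserts the letter at p into the
    subword on J, or deletes it from there. It depends on the positions of J
    before p only. *)
Definition letter_refl J p : W := q p ^ (subprod (below_pos J p))^-1.

Lemma letter_refl_is_reflection J p : reflection S (letter_refl J p).
Proof. by apply: reflection_generator; exact: letterS. Qed.

Lemma below_pos_eq J I (p : nat) :
  (forall i : 'I_r, i < p -> (i \in J) = (i \in I)) ->
    below_pos J p = below_pos I p.
Proof.
by move=> JI; apply/setP=> i; rewrite !inE; case: ltnP => [/JI->//|];
  rewrite !andbF.
Qed.

Lemma from_pos_eq J I (p : nat) :
  (forall i : 'I_r, p <= i -> (i \in J) = (i \in I)) ->
    from_pos J p = from_pos I p.
Proof.
by move=> JI; apply/setP=> i; rewrite !inE; case: leqP => [/JI->//|];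
  rewrite !andbF.
Qed.

Lemma letter_refl_eq J I p :
  (forall i : 'I_r, i < p -> (i \in J) = (i \in I)) ->
    letter_refl J p = letter_refl I p.
Proof. by move=> JI; rewrite /letter_refl (below_pos_eq JI). Qed.

Lemma letter_refl_add J p : p \notin J -> letter_refl J p * subprod J =
  subprod (p |: J).
Proof.
move=> pJ; rewrite (subprod_split J p) (subprod_split (p |: J) p) !subprod_from.
rewrite (negPf pJ) setU11 mul1g.
rewrite (@below_pos_eq (p |: J) J) => [|i ip];
  last by rewrite !inE -val_eqE ltn_eqF.
rewrite (@from_pos_eq (p |: J) J) => [|i ip];
  last by rewrite !inE -val_eqE gtn_eqF.
by rewrite /letter_refl conjgE invgK -!mulgA mulKg.
Qed.

Lemma letter_refl_mulxx J p : letter_refl J p * letter_refl J p = 1.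
Proof. exact: (reflection_mulxx cox (letter_refl_is_reflection J p)). Qed.

Lemma letter_refl_del J p : p \in J -> letter_refl J p * subprod J =
  subprod (J :\ p).
Proof.
move=> pJ; rewrite -{2}(setD1K pJ) -letter_refl_add ?setD11 //.
rewrite (@letter_refl_eq (J :\ p) J) => [|i ip];
  first by rewrite mulgA letter_refl_mulxx mul1g.
by rewrite !inE -val_eqE ltn_eqF.
Qed.

(** Two letters with the same reflection could both be deleted without changing
    the product. *)
Lemma letter_refl_inj J p p' : #|J| = len S (subprod J) -> p \in J ->
  p' \in J ->
  letter_refl J p = letter_refl J p' -> p = p'.
Proof.
move=> rJ; wlog lt : p p' / p < p' => [wl|] pJ p'J eqt.
  by have [||/val_inj//] := ltngtP p p' => lt; [|apply/esym]; exact: wl.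
have pJ' : p \in J :\ p' by rewrite !inE -val_eqE ltn_eqF.
have : subprod (J :\ p' :\ p) = subprod J.
  rewrite -letter_refl_del // (@letter_refl_eq (J :\ p') J) => [|i ip].
    by rewrite -letter_refl_del // mulgA eqt letter_refl_mulxx mul1g.
  by rewrite !inE -val_eqE ltn_eqF // (ltn_trans ip).
move=> eqP; have := len_subprod (J :\ p' :\ p).
rewrite eqP -rJ; have := cardsD1 p' J; have := cardsD1 p (J :\ p').
by rewrite p'J pJ' !add1n => E1 E2; rewrite E2 E1 => /ltnW; rewrite ltnn.
Qed.

Lemma letter_refl_exchange J t : reflection S t ->
  len S (t * subprod J) < len S (subprod J) ->
    exists2 p, p \in J & letter_refl J p = t.
Proof.
move=> rt lt; have eJ : expression S (subword Q J) (subprod J).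
  by split; [exact: subwordS|exact: subprod_subword].
have [w1 [s [w2 [wE tE]]]] := strong_exchange cox rt eJ lt.
have := cardE J; rewrite -(size_map q) -/(subword Q J) wE size_cat /= => szJ.
have ltJ : size w1 < size (enum J) by rewrite -cardE szJ; lia.
have [p0 _] : exists p, p \in J by apply/card_gt0P; rewrite szJ addnS.
pose p := nth p0 (enum J) (size w1).
have pJ : p \in J by rewrite -mem_enum mem_nth.
have e1 : map q (take (size w1) (enum J)) = w1.
  by rewrite map_take -/(subword Q J) wE take_size_cat.
have pq : q p = s.
  rewrite -(nth_map p0 (q p0)) // -/(subword Q J) wE nth_cat ltnn subnn //.
exists p => //; rewrite /letter_refl tE pq; congr (_ ^ _^-1).
rewrite /subprod -e1 big_map; congr (\big[_/_]_(i <- _) _).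
have pn : index p (enum J) = size (enum (below_pos J p)).
  rewrite (enum_at pJ) index_cat mem_enum !inE ltnn andbF /= eqxx addn0 //.
rewrite -(take_size_cat (p :: enum (from_pos J p.+1)) (erefl (size (enum
  (below_pos J p))))).
by rewrite -enum_at // -pn index_uniq // enum_uniq.
Qed.

(** Inserting j and deleting p multiplies by both reflections, in an order that
    depends on which position comes first; either way the product is unchanged
    only if the two involutions agree. *)
Lemma flip_prod J j p : j \notin J -> p \in J ->
  (subprod ((j |: J) :\ p) == subprod J) = (letter_refl J p == letter_refl J j).
Proof.
move=> jJ pJ; have njp : j != p by apply: contraNneq jJ => ->.
have involE (t u x : W) : t * t = 1 -> u * u = 1 ->
  (t * (u * x) == x) = (t == u).
  move=> tt uu; rewrite mulgA -[X in _ == X]mul1g (inj_eq (mulIg _)).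
  by rewrite -[X in _ == X]uu (inj_eq (mulIg _)).
have [ltjp|ltpj|/val_inj ejp] := ltngtP j p; last by rewrite ejp eqxx in njp.
  have -> : (j |: J) :\ p = j |: (J :\ p).
    by apply/setP=> i; rewrite !inE; case: eqVneq => // ->;
      rewrite eq_sym (negPf njp).
  rewrite -letter_refl_add ?inE ?(negPf jJ) ?andbF //.
  rewrite (@letter_refl_eq (J :\ p) J) => [|i ip]; last first.
    by rewrite !inE -val_eqE ltn_eqF // (ltn_trans ip).
  by rewrite -letter_refl_del // involE ?letter_refl_mulxx // eq_sym.
rewrite -letter_refl_del ?inE ?pJ ?orbT // (@letter_refl_eq (j |: J) J) =>
  [|i ip]; last first.
  by rewrite !inE -val_eqE ltn_eqF // (ltn_trans ip).
by rewrite -letter_refl_add // involE ?letter_refl_mulxx.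
Qed.

End Positions.

(** * The Demazure product dominates all subword products *)

Section Prefixes.
Local Open Scope group_scope.
Variables (W : finGroupType) (S : {set W}) (cox : coxeter_system S).
Variables (r : nat) (Q : r.-tuple W) (QS : {subset Q <= S}).
Implicit Types (I J F G H : {set 'I_r}) (p j : 'I_r).
Local Notation q := (tnth Q).
Local Notation subprod := (subprod Q).
Local Notation letter_refl := (letter_refl Q).

Definition prefix_demazure (k : nat) := demazure S (take k Q).

Lemma prefix_demazureS p :
  prefix_demazure p.+1 = demazure_step S (prefix_demazure p) (q p).
Proof.
rewrite /prefix_demazure (take_nth (q p)) ?size_tuple //.
by rewrite demazure_rcons -tnth_nth.
Qed.

Lemma subprod_belowS J p :
  subprod (below_pos J p.+1) = subprod (below_pos J p) *
    (if p \in J then q p else 1).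
Proof.
rewrite (subprod_split _ _ p) subprod_from !inE ltnSn andbT.
rewrite (_ : from_pos (below_pos J p.+1) p.+1 = set0) ?subprod0 ?mulg1;
  last first.
  by apply/setP=> i; rewrite !inE; case: (i \in J) => //=; lia.
by congr (subprod _ * _); apply/setP=> i; rewrite !inE -andbA; congr (_ && _);
  lia.
Qed.

Lemma below_bruhat_demazure J k : k <= r ->
  bruhat S (subprod (below_pos J k)) (prefix_demazure k).
Proof.
elim: k => [|k IH] kr.
  rewrite /prefix_demazure take0 (_ : below_pos J 0 = set0) ?subprod0;
    first exact: bruhat_refl.
  by apply/setP=> i; rewrite !inE ltn0 andbF.
pose p := Ordinal kr; rewrite (subprod_belowS J p) (prefix_demazureS p).
have [b bq] := bruhat_demazure_step cox (letterS QS p) (IH (ltnW kr)).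
by case: (p \in J); rewrite ?mulg1.
Qed.

Lemma subprod_bruhat_demazure J : bruhat S (subprod J) (demazure S Q).
Proof.
have := below_bruhat_demazure J (leqnn r).
rewrite /prefix_demazure take_oversize ?size_tuple //.
by congr (bruhat _ (subprod _) _); apply/setP=> i; rewrite !inE ltn_ord andbT.
Qed.

End Prefixes.

(** * Flips of facets and shellings that end with a given star *)

Lemma sum_pow2_lt (I : finType) (P : pred I) (e : I -> nat) n :
  injective e -> (forall i, P i -> e i < n) -> \sum_(i | P i) 2 ^ e i < 2 ^ n.
Proof.
move=> inj_e; elim: n P => [|n IH] P Pn.
  by rewrite big_pred0 // => i; apply/negP => /Pn; rewrite ltn0.
have IH' : \sum_(i | P i && (e i != n)) 2 ^ e i < 2 ^ n.
  by apply: IH => i /andP[/Pn]; rewrite ltnS leq_eqVlt => /orP[->|].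
have [/existsP[i /andP[Pi /eqP ei]]|nP] := boolP [exists i, P i && (e i == n)].
  rewrite (bigD1 i) //= ei expnS mul2n -addnn ltn_add2l.
  by under eq_bigl do rewrite -(inj_eq inj_e) ei.
rewrite (eq_bigl (fun i => P i && (e i != n))).
  by apply: ltn_trans IH' _; rewrite ltn_exp2l.
move=> i /=; case Pi: (P i) => //=; apply/esym; apply: contraNneq nP => ei.
by apply/existsP; exists i; rewrite Pi ei eqxx.
Qed.

Section Flips.
Local Open Scope group_scope.
Variables (W : finGroupType) (S : {set W}) (cox : coxeter_system S).
Variables (r : nat) (Q : r.-tuple W) (QS : {subset Q <= S}) (x : W).
Implicit Types (I J F G H : {set 'I_r}) (p j : 'I_r).
Local Notation q := (tnth Q).
Local Notation subprod := (subprod Q).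
Local Notation letter_refl := (letter_refl Q).
Local Notation D := (subword_complex S Q x).

Lemma facetE F : F \in facets D <-> subprod (~: F) = x /\ #|~: F| = len S x.
Proof. by rewrite facets_subword_complex (reducedE cox). Qed.

Lemma card_facet F : F \in facets D -> #|F| + len S x = r.
Proof. by case/facetE => _ <-; rewrite cardsC card_ord. Qed.

Lemma facet_flipP F j p : F \in facets D -> j \in F -> p \notin F ->
  (p |: F :\ j \in facets D) = (letter_refl (~: F) p == letter_refl (~: F) j).
Proof.
move=> fF jF pF; have [eF cF] := (facetE F).1 fF.
have jF' : j \notin ~: F by rewrite inE negbK.
have pF' : p \in ~: F by rewrite inE.
rewrite -(flip_prod cox QS jF' pF') eF.
have njp : j != p by apply: contraNneq pF => <-.
have -> : (j |: ~: F) :\ p = ~: (p |: F :\ j).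
  by apply/setP=> i; rewrite !inE !negb_or negb_and negbK.
apply/idP/eqP => [/facetE[]//|e]; apply/facetE; split=> //.
rewrite -cF; apply/eqP; rewrite -(eqn_add2l #|p |: F :\ j|) cardsC.
rewrite cardsU1 !inE (negPf pF) andbF add1n -(cardsC F) (cardsD1 j F) jF.
by [].
Qed.

Lemma facet_neighbor F G j : F \in facets D -> G \in facets D -> j \in F ->
  F :\ j \subset G -> G != F -> exists2 p, p \notin F & G = p |: F :\ j.
Proof.
move=> fF fG jF sFG neq.
have cFG : #|F| = #|G|.
  by apply/eqP; rewrite -(eqn_add2r (len S x)) !card_facet.
have : ~~ (G \subset F) by apply: contra neq => sGF;
  rewrite eqEcard sGF cFG leqnn.
case/subsetPn => p pG pF; exists p => //; apply/esym/eqP; rewrite eqEcard.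
rewrite subUset sub1set pG sFG /= cardsU1 !inE (negPf pF) andbF -cFG.
by rewrite (cardsD1 j F) jF.
Qed.

Lemma facet_flip_unique F G H j :
  F \in facets D -> G \in facets D -> H \in facets D -> j \in F ->
  F :\ j \subset G -> F :\ j \subset H -> G != F -> H != F -> G = H.
Proof.
move=> fF fG fH jF sG sH nG nH.
have [p pF eG] := facet_neighbor fF fG jF sG nG.
have [p' p'F eH] := facet_neighbor fF fH jF sH nH.
rewrite eG eH; suff -> : p = p' by [].
move: fG fH; rewrite eG eH !facet_flipP // => /eqP ep /eqP ep'.
have [eF cF] := (facetE F).1 fF.
by apply: (letter_refl_inj cox QS (J := ~: F)); rewrite ?eF ?inE // ep ep'.
Qed.

(* By Bruhat domination this says that x is the Demazure product of Q, as soon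
   as the complex has a facet. *)
Hypothesis dem : forall J, bruhat S (subprod J) x.

(** Inserting j into the reduced word on the complement of F multiplies x by a
    reflection. The product stays below x in Bruhat order, hence is shorter,
    and the exchange property finds the letter to delete. *)
Lemma facet_flip_exists F j : F \in facets D -> j \in F ->
  exists p, [/\ p \notin F, p |: F :\ j \in facets D &
                letter_refl (~: F) p = letter_refl (~: F) j].
Proof.
move=> fF jF; have [eF cF] := (facetE F).1 fF.
have jF' : j \notin ~: F by rewrite inE negbK.
have rj := letter_refl_is_reflection QS (~: F) j.
have [] := bruhat_len (dem (j |: ~: F)); rewrite -(letter_refl_add _ jF') eF.
  by move=> e; have := len_reflection cox x rj; rewrite e eqxx.
move=> lt; have [|p] := letter_refl_exchange cox QS rj (J := ~: F);
  first by rewrite eF.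
rewrite inE => pF ep.
by exists p; split=> //; rewrite facet_flipP // ep.
Qed.

Variable k : 'I_r.

(** The place of i in the cyclic order k + 1, ..., r, 1, ..., k, in which k is
    the heaviest position. *)
Definition cyclic_weight (i : 'I_r) : nat :=
  if i <= k then i + (r - k.+1) else i - k.+1.

Lemma cyclic_weight_inj : injective cyclic_weight.
Proof.
move=> i j e; apply: val_inj => /=; move: e; rewrite /cyclic_weight.
have := ltn_ord i; have := ltn_ord j; have := ltn_ord k.
by case: (leqP i k) => ?; case: (leqP j k) => ?; lia.
Qed.

Lemma cyclic_weight_max i : i != k -> cyclic_weight i < cyclic_weight k.
Proof.
rewrite -val_eqE /= /cyclic_weight leqnn.
by have := ltn_ord i; have := ltn_ord k; case: (leqP i k) => ?; lia.
Qed.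

(** Binary expansion with these weights encodes the lexicographic comparison of
    facets that looks at heavy positions first. *)
Definition facet_rank F : nat := \sum_(i in F) 2 ^ cyclic_weight i.

Lemma facet_rank_lt F G p : p \in G -> p \notin F ->
  (forall i, cyclic_weight p < cyclic_weight i -> (i \in F) = (i \in G)) ->
  facet_rank F < facet_rank G.
Proof.
move=> pG pF FG; rewrite /facet_rank.
rewrite (bigID (fun i => cyclic_weight i < cyclic_weight p)) /=.
rewrite [X in _ < X](bigID (fun i => cyclic_weight i <= cyclic_weight p)) /=.
have -> : \sum_(i in F | ~~ (cyclic_weight i < cyclic_weight p)) 2 ^
  cyclic_weight i
   = \sum_(i in G | ~~ (cyclic_weight i <= cyclic_weight p)) 2 ^ cyclic_weight
     i.
  apply: eq_bigl => i; rewrite -leqNgt -ltnNge leq_eqVlt.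
  case: eqP => [/cyclic_weight_inj <-|_]; first by rewrite
    (negPf pF) ltnn andbF.
  by case: ltnP => [/FG->|]; rewrite ?andbF.
rewrite ltn_add2r; apply: (@leq_trans (2 ^ cyclic_weight p)%N).
  by apply: sum_pow2_lt => [|i /andP[]//]; exact: cyclic_weight_inj.
by rewrite (bigD1 p) ?pG ?leqnn //= leq_addr.
Qed.

Lemma first_difference F G : F != G ->
  exists p, ((p \in F) != (p \in G)) /\
    (forall i, cyclic_weight p < cyclic_weight i -> (i \in F) = (i \in G)).
Proof.
move=> nFG; have /existsP[p0 p0P] : [exists p, (p \in F) != (p \in G)].
  apply: contraNT nFG; rewrite negb_exists => /forallP eFG.
  by apply/eqP/setP=> i; apply/eqP; have := eFG i; rewrite negbK.
case: (@arg_maxnP _ p0 (fun p => (p \in F) != (p \in G)) cyclic_weight p0P).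
move=> p pP maxp; exists p; split=> // i lt; apply/eqP/negbNE/negP => /maxp.
by rewrite /= leqNgt lt.
Qed.

Lemma facet_rank_cmp F G : F != G -> facet_rank F <= facet_rank G ->
  exists p, [/\ p \in G, p \notin F &
    forall i, cyclic_weight p < cyclic_weight i -> (i \in F) = (i \in G)].
Proof.
move=> /first_difference[p [pFG agree]].
have [pG|pG] := boolP (p \in G); first by exists p; move: pFG;
  rewrite pG eqb_id.
have pF : p \in F by move: pFG; rewrite (negPf pG); case: (p \in F).
rewrite leqNgt (facet_rank_lt pF pG) // => i /agree -> //.
Qed.

Lemma facet_rank_inj : injective facet_rank.
Proof.
move=> F G e; apply/eqP/negPn/negP => n.
have [p [pG pF agree]] := facet_rank_cmp n (eq_leq e).
by have := facet_rank_lt pG pF agree; rewrite e ltnn.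
Qed.

Lemma facet_rank_last F G : k \in G -> k \notin F ->
  facet_rank F < facet_rank G.
Proof.
move=> kG kF; apply: (facet_rank_lt kG kF) => i lt.
have nik : i != k by apply: contraTneq lt => ->; rewrite ltnn.
by have := cyclic_weight_max nik; rewrite ltnNge ltnW.
Qed.

(** Suppose p' were heavier than p; F and G agree on all positions heavier than
    p. If p < p', these include the ones from p + 1 to p'. The letters outside G
    strictly between p and p' have a product y with q_p = y q_p' y^-1, and the
    letters outside F there are the same. If p' < p, they include the positions
    up to p', which determine the reflection of p', and those after p, which
    together with the total product x determine the reflection of p. In both
    cases p and p' would have the same reflection in the reduced complement of
    F. *)
Lemma facet_flip_down F G p p' : F \in facets D -> G \in facets D ->
  p \in G -> p \notin F -> p' \notin G ->
  (forall i, cyclic_weight p < cyclic_weight i -> (i \in F) = (i \in G)) ->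
  letter_refl (~: G) p' = letter_refl (~: G) p ->
    cyclic_weight p' < cyclic_weight p.
Proof.
move=> fF fG pG pF p'G agree refl_eq.
have npp' : p != p' by apply: contraNneq p'G => <-.
have [//|] := ltnP (cyclic_weight p') (cyclic_weight p).
rewrite leq_eqVlt (inj_eq cyclic_weight_inj) (negPf npp') /= => lt.
have p'F : p' \notin F by rewrite agree.
have [eF cF] := (facetE F).1 fF; have [eG cG] := (facetE G).1 fG.
suff /(letter_refl_inj cox QS) : letter_refl (~: F) p = letter_refl (~: F) p'.
  by rewrite eF !inE => /(_ cF pF p'F) e; rewrite e eqxx in npp'.
have qV i : (q i)^-1 = q i := generator_inv cox (letterS QS i).
have belowF : subprod (below_pos (~: F) p) * q p * subprod (from_pos
  (~: F) p.+1) = x.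
  by rewrite -eF (subprod_split _ (~: F) p) subprod_from inE pF mulgA.
have belowG : subprod (below_pos (~: G) p) * subprod (from_pos (~: G) p.+1) = x.
  by rewrite -eG (subprod_split _ (~: G) p) subprod_from inE pG mul1g.
have [ltpp'|ltp'p] := ltnP p p'.
  have between : from_pos (below_pos (~: F) p') p.+1 =
    from_pos (below_pos (~: G) p') p.+1.
    apply/setP=> i; rewrite !inE.
    have [ip'|] := ltnP i p'; last by rewrite !andbF.
    have [pi|] := ltnP p i; last by rewrite !andbF.
    rewrite agree //; move: lt; rewrite /cyclic_weight.
    have := ltn_ord p'; have := ltn_ord k.
    by case: (leqP i k) => ?; case: (leqP p k) => ?; case: (leqP p' k) => ?;
      lia.
  have split_below J : below_pos (below_pos J p') p = below_pos J p.
    by apply/setP=> i; rewrite !inE -andbA; congr (_ && _); lia.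
  move: refl_eq; rewrite /letter_refl.
  rewrite (subprod_split _ (below_pos (~: F) p') p) (subprod_split _
    (below_pos (~: G) p') p).
  rewrite !subprod_from between !split_below !inE ltpp' pF pG /= mul1g !invMg
    !conjgM.
  move=> /conjg_inj ->.
  by rewrite qV [q p ^ q p]conjgE mulKg.
have below_p' : below_pos (~: F) p' = below_pos (~: G) p'.
  apply: below_pos_eq => i ip'; rewrite !inE agree //.
  move: lt; rewrite /cyclic_weight; have := ltn_ord p; have := ltn_ord k.
  by case: (leqP i k) => ?; case: (leqP p k) => ?; case: (leqP p' k) => ?; lia.
have from_p : from_pos (~: F) p.+1 = from_pos (~: G) p.+1.
  apply: from_pos_eq => i ip; rewrite !inE agree //; move: npp' lt.
  rewrite -val_eqE /cyclic_weight /=; have := ltn_ord p.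
  have := ltn_ord i; have := ltn_ord k.
  by case: (leqP i k) => ?; case: (leqP p k) => ?; case: (leqP p' k) => ?; lia.
have -> : letter_refl (~: F) p' = letter_refl
  (~: G) p' by rewrite /letter_refl below_p'.
rewrite refl_eq /letter_refl.
have -> : subprod (below_pos (~: F) p) = subprod (below_pos (~: G) p) *
  (q p)^-1.
  apply: (mulIg (q p)); rewrite mulgKV; apply: (mulIg (subprod (from_pos
    (~: F) p.+1))).
  by rewrite belowF from_p belowG.
by rewrite invMg invgK conjgM [q p ^ q p]conjgE mulKg.
Qed.

Lemma facet_shelling F G : F \in facets D -> G \in facets D ->
  facet_rank F < facet_rank G ->
  exists j H, [/\ j \in G, H \in facets D, facet_rank H < facet_rank G,
                  G :\ j \subset H & F :&: G \subset H].
Proof.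
move=> fF fG lt; have nFG : F != G by apply: contraTneq lt => ->; rewrite ltnn.
have [p [pG pF agree]] := facet_rank_cmp nFG (ltnW lt).
have [p' [p'G fH ep']] := facet_flip_exists fG pG.
have ltp'p := facet_flip_down fF fG pG pF p'G agree ep'.
have npp' : p != p' by apply: contraNneq p'G => <-.
exists p, (p' |: G :\ p); split=> //; last 2 first.
- exact: subsetUr.
- apply/subsetP=> i; rewrite !inE => /andP[iF ->]; rewrite andbT.
  by apply/orP; right; apply: contraTneq iF => ->.
apply: (facet_rank_lt pG); first by rewrite !inE eqxx orbF.
move=> i lti; rewrite !inE.
have -> : (i == p') = false by apply: contraTF lti => /eqP ->;
  rewrite -leqNgt ltnW.
by have -> : (i == p) = false by apply: contraTF lti => /eqP ->; rewrite ltnn.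
Qed.

End Flips.

(** * Reconstruction from the facet-ridge graph *)

(** A shelling is encoded by a rank function. The shelling condition reads:
    whenever F precedes G, a neighbor of G that also precedes G contains the
    intersection of F and G. *)
Record shellable_pseudomanifold (V : finType) (D : complex V) : Prop := {
  facets_same_card : forall F G : {set V}, F \in facets D -> G \in facets D ->
    #|F| = #|G|;
  neighbor_unique : forall (F G H : {set V}) j,
    F \in facets D -> G \in facets D -> H \in facets D -> j \in F ->
    F :\ j \subset G -> F :\ j \subset H -> G != F -> H != F -> G = H;
  neighbor_exists : forall (F : {set V}) j, F \in facets D -> j \in F ->
    exists G, [/\ G \in facets D, G != F & F :\ j \subset G];
  star_last_shelling : forall v, v \in vertices D ->
    exists e : {set V} -> nat,
      [/\ injective e,
          forall F G : {set V}, v \in G -> v \notin F -> e F < e G &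
          forall F G : {set V}, F \in facets D -> G \in facets D -> e F < e G ->
          exists j H, [/\ j \in G, H \in facets D, e H < e G,
                          G :\ j \subset H & F :&: G \subset H]] }.

Lemma some_inj (T : Type) : injective (@Some T).
Proof. by move=> x y []. Qed.

Section SourcePairs.
Variables (T : finType) (adj : rel T) (e : T -> nat).

Definition source_pairs : {set T * T} :=
  [set p | adj p.1 p.2 & [forall y, adj p.1 y ==> (y != p.2) ==>
    (e p.1 < e y)]].

Lemma source_pairsP x y :
  reflect (adj x y /\ forall z, adj x z -> z != y -> e x < e z)
          ((x, y) \in source_pairs).
Proof.
rewrite inE /=; apply: (iffP andP) => -[xy min]; split=> //.
  by move=> z xz zy; have /forallP/(_ z) := min; rewrite xz zy.
by apply/forallP=> z; apply/implyP=> xz; apply/implyP=> zy; exact: min.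
Qed.

End SourcePairs.

(** Source pairs are defined by the graph and the ranking alone. *)
Lemma card_source_pairs (T T' : finType) (adj : rel T) (adj' : rel T')
    (f : T -> T') (h : T' -> T) (e : T -> nat) :
  cancel f h -> cancel h f -> (forall x y, adj' (f x) (f y) = adj x y) ->
  #|source_pairs adj' (e \o h)| = #|source_pairs adj e|.
Proof.
move=> fK hK fadj; pose ff (p : T * T) := (f p.1, f p.2).
have ff_inj : injective ff by move=> [x y] [x' y']
  [/(can_inj fK)-> /(can_inj fK)->].
rewrite -(card_imset _ ff_inj); apply: eq_card => -[x' y'].
rewrite -(hK x') -(hK y'); move: (h x') (h y') => x y.
apply/idP/imsetP => [/source_pairsP[] | [[u w] /source_pairsP[uw min]
  [/(can_inj fK)-> /(can_inj fK)->]]].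
  rewrite fadj => xy min; exists (x, y) => //; apply/source_pairsP;
    split=> // z xz zy.
  have := min (f z); rewrite fadj /= !fK; apply=> //.
  by rewrite (can_eq fK).
apply/source_pairsP; split; first by rewrite fadj.
move=> z; rewrite -(hK z) fadj (can_eq fK) /= !fK; exact: min.
Qed.

Section Pseudomanifold.
Variables (V : finType) (D : complex V).
Hypothesis pm : shellable_pseudomanifold D.
Implicit Types (F G H : facet D) (v w : V).

(** The default F is never used when v lies in F. *)
Definition neighbor F v : facet D :=
  odflt F [pick G : facet D | (G != F) && (val F :\ v \subset val G)].

Lemma neighborP F v : v \in val F ->
  [/\ neighbor F v != F, val F :\ v \subset val (neighbor F v) &
      v \notin val (neighbor F v)].
Proof.
move=> vF; rewrite /neighbor; case: pickP => [G /andP[nGF sG]|no] /=.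
  split=> //; apply: contra nGF => vG; rewrite -val_eqE /= eq_sym eqEcard.
  rewrite (facets_same_card pm (valP G) (valP F)) leqnn andbT.
  by rewrite -(setD1K vF) subUset sub1set vG.
have [G [fG nGF sG]] := neighbor_exists pm (valP F) vF.
by have := no (exist _ G fG); rewrite -val_eqE /= nGF sG.
Qed.

Lemma neighbor_eq F G v : v \in val F -> G != F -> val F :\ v \subset val G ->
  G = neighbor F v.
Proof.
move=> vF nGF sG; have [nN sN _] := neighborP vF; apply: val_inj.
exact: (neighbor_unique pm (valP F) (valP G) (valP _) vF sG sN).
Qed.

Lemma FRP F G : reflect (exists2 v, v \in val F & G = neighbor F v) (FR F G).
Proof.
apply: (iffP andP) => [[nFG /existsP[R /andP[/existsP[v /andP[vF /eqP RF]]]]]|].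
  case/existsP => w /andP[_ /eqP RG]; exists v => //.
  by apply: neighbor_eq; rewrite // 1?eq_sym // -RF RG subD1set.
case=> v vF ->; have [nN sN vN] := neighborP vF; split; first by rewrite eq_sym.
apply/existsP; exists (val F :\ v); apply/andP; split.
  by apply/existsP; exists v; rewrite vF eqxx.
have : ~~ (val (neighbor F v) \subset val F).
  apply: contra nN => sNF; rewrite -val_eqE eqEcard sNF.
  by rewrite (facets_same_card pm (valP F) (valP (neighbor F v))) leqnn.
case/subsetPn => w wN wF; apply/existsP; exists w; rewrite wN /= eqEcard.
rewrite subsetD1 sN !inE (negPf wF) andbF /=.
have := facets_same_card pm (valP (neighbor F v)) (valP F).
by rewrite (cardsD1 w) wN (cardsD1 v (val F)) vF => /addnI ->.
Qed.

Lemma FR_neighbor F v : v \in val F -> FR F (neighbor F v).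
Proof. by move=> vF; apply/FRP; exists v. Qed.

Lemma FR_sym F G : FR F G = FR G F.
Proof.
by rewrite /FR eq_sym; congr (_ && _); apply: eq_existsb => R; rewrite andbC.
Qed.

Lemma mem_neighbor F v w : v \in val F -> w \in val F ->
  (w \in val (neighbor F v)) = (w != v).
Proof.
move=> vF wF; have [_ sN vN] := neighborP vF.
have [->|nwv] := eqVneq w v; first exact: negbTE.
by apply: (fintype.subsetP sN); rewrite !inE nwv.
Qed.

Lemma vertex_facet v : v \in vertices D -> exists F, v \in val F.
Proof.
rewrite inE => vD; have [F maxF] := maxset_exists (P := [in faces D]) vD.
rewrite sub1set => vF.
have fF : F \in facets D by rewrite inE.
by exists (exist _ F fF).
Qed.

Lemma facet_vertex F v : v \in val F -> v \in vertices D.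
Proof.
move=> vF; rewrite inE; apply: faces_closed (facets_faces (valP F)).
by rewrite sub1set.
Qed.

Lemma same_star_eq v w : v \in vertices D ->
  (forall F, (v \in val F) = (w \in val F)) -> v = w.
Proof.
case/vertex_facet => F vF vw; have wF : w \in val F by rewrite -vw.
have := vw (neighbor F v); rewrite !mem_neighbor // eqxx.
by case: eqVneq.
Qed.

Section Ranking.
Variable e : facet D -> nat.
Hypothesis e_inj : injective e.

Definition removed (p : facet D * facet D) : option V :=
  [pick v in val p.1 :\: val p.2].

Lemma removed_neighbor F v : v \in val F -> removed (F, neighbor F v) = Some v.
Proof.
move=> vF; rewrite /removed; case: pickP => [w|/(_ v)] /=; rewrite !inE.
  by case: (boolP (w \in val F)) => wF; rewrite ?andbF // mem_neighbor //
    andbT negbK => /eqP->.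
by rewrite vF andbT; have [_ _ ->] := neighborP vF.
Qed.

Lemma first_source v : v \in vertices D -> exists F,
  [/\ v \in val F, (F, neighbor F v) \in source_pairs (@FR V D) e &
      forall G, v \in val G -> e F <= e G].
Proof.
case/vertex_facet => F0 vF0.
case: (@arg_minnP _ F0 (fun F => v \in val F) e vF0) => F vF minF.
exists F; split=> //; apply/source_pairsP; split; first exact: FR_neighbor.
move=> _ /FRP[u uF ->] nuv; rewrite ltn_neqAle (inj_eq e_inj) eq_sym.
have [-> _ _] := neighborP uF; apply: minF; rewrite mem_neighbor //.
by apply: contraNneq nuv => ->.
Qed.

Definition unique_sources := forall F v, v \in val F ->
  (F, neighbor F v) \in source_pairs (@FR V D) e ->
  forall G, v \in val G -> e F <= e G.

(** The minimum of the star of v is a source from which v is removed. *)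
Lemma card_vertices_removed :
  #|vertices D| <= #|removed @: source_pairs (@FR V D) e|.
Proof.
rewrite -(card_imset _ (@some_inj V)); apply/subset_leq_card/fintype.subsetP.
move=> _ /imsetP[v vD ->]; have [F [vF srcF _]] := first_source vD.
by rewrite -(removed_neighbor vF) imset_f.
Qed.

Lemma card_vertices_le : #|vertices D| <= #|source_pairs (@FR V D) e|.
Proof. exact: leq_trans card_vertices_removed (leq_imset_card _ _). Qed.

Lemma unique_sources_card :
  unique_sources -> #|source_pairs (@FR V D) e| = #|vertices D|.
Proof.
move=> us; apply/eqP; rewrite eqn_leq card_vertices_le andbT.
have inj : {in source_pairs (@FR V D) e &, injective removed}.
  move=> [F G] [F' G'] src src'.
  have /source_pairsP[/FRP[v vF GE] _] := src.
  have /source_pairsP[/FRP[v' vF' GE'] _] := src'.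
  rewrite GE GE' !removed_neighbor // => -[vv']; rewrite -vv' in vF' GE' *.
  rewrite GE in src; rewrite GE' in src'.
  suff -> : F = F' by [].
  by apply: e_inj; apply/eqP; rewrite eqn_leq (us F v) // (us F' v).
rewrite -(card_in_imset inj) -(card_imset _ (@some_inj V)).
apply/subset_leq_card/fintype.subsetP => _ /imsetP[[F G]
  /source_pairsP[/FRP[v vF ->] _] ->].
by rewrite removed_neighbor // imset_f // (facet_vertex vF).
Qed.

(** If there are no more source pairs than vertices, the removed vertex
    determines the pair, so the only source of a star is its minimum. *)
Lemma card_unique_sources :
  #|source_pairs (@FR V D) e| <= #|vertices D| -> unique_sources.
Proof.
move=> le.
have /imset_injP inj : #|removed @: source_pairs (@FR V D) e| ==
  #|source_pairs (@FR V D) e|.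
  by rewrite eqn_leq leq_imset_card (leq_trans le card_vertices_removed).
move=> F v vF src G vG; have [F' [vF' src' min]] := first_source
  (facet_vertex vF).
have [->] : (F, neighbor F v) = (F', neighbor F' v).
  by apply: inj => //; rewrite !removed_neighbor.
by move=> _; exact: min.
Qed.

End Ranking.

(** A second source of the star of w would have an earlier facet of that star,
    hence by the shelling condition an earlier neighbor in the star. *)
Lemma shelling_ranking v : v \in vertices D -> exists e : facet D -> nat,
  [/\ injective e, unique_sources e,
      forall F G, v \in val G -> v \notin val F -> e F < e G &
      forall F G, v \in val F -> v \in val G -> e F < e G ->
        exists H, [/\ FR G H, v \in val H & e H < e G]].
Proof.
move=> vD; have [e [e_inj last shell]] := star_last_shelling pm vD.
have step F G : e (val F) < e (val G) -> exists H,
    [/\ FR G H, e (val H) < e (val G) & val F :&: val G \subset val H].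
  move=> /(shell _ _ (valP F) (valP G))[j [H [jG fH lt sG sFG]]].
  exists (exist _ H fH); split=> //; apply/FRP; exists j => //.
  apply: neighbor_eq => //; apply: contraTneq lt => /(congr1 val)/= ->.
  by rewrite ltnn.
exists (e \o val); split=> [||F G|F G vF vG lt].
- exact: inj_comp e_inj val_inj.
- move=> F w wF /source_pairsP[_ src] G wG; rewrite leqNgt; apply/negP => lt.
  have [H [FRH ltH sH]] := step _ _ lt.
  have wH : w \in val H by apply: (fintype.subsetP sH); rewrite inE wG.
  suff : e (val F) < e (val H) by rewrite ltnNge ltnW.
  apply: src => //; apply: contraTneq wH => ->.
  by have [_ _] := neighborP wF.
- exact: last.
have [H [FRH ltH sH]] := step _ _ lt; exists H; split=> //.
by apply: (fintype.subsetP sH); rewrite inE vF.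
Qed.

End Pseudomanifold.

Section VertexCorrespondence.
Variables (V V' : finType) (A : complex V) (B : complex V').
Hypotheses (pmA : shellable_pseudomanifold A)
  (pmB : shellable_pseudomanifold B).
Variables (f : facet A -> facet B) (h : facet B -> facet A).
Hypotheses (fK : cancel f h) (hK : cancel h f).
Hypothesis f_FR : forall F G, FR (f F) (f G) = FR F G.

Lemma card_vertices_iso v : v \in vertices A -> #|vertices B| <= #|vertices A|.
Proof.
case/(shelling_ranking pmA) => e [e_inj us _ _].
rewrite -(unique_sources_card pmA e_inj us) -(card_source_pairs _ fK hK f_FR).
exact: (card_vertices_le pmB (inj_comp e_inj (can_inj hK))).
Qed.

End VertexCorrespondence.

Section VertexMap.
Variables (V V' : finType) (A : complex V) (B : complex V').
Hypotheses (pmA : shellable_pseudomanifold A)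
  (pmB : shellable_pseudomanifold B).
Variables (f : facet A -> facet B) (h : facet B -> facet A).
Hypotheses (fK : cancel f h) (hK : cancel h f).
Hypothesis f_FR : forall F G, FR (f F) (f G) = FR F G.

(** Let F0 be the minimum of the star of v and w the vertex that f F0 loses
    towards the image of its neighbor across v. Then f F0 is the minimum of the
    star of w, and since the star of v is a final segment it contains the
    preimage of the star of w (starB). Conversely, descending paths in the star
    of v lead to F0, and along them membership of the images in the star of w
    propagates upwards (starA). *)
Lemma star_image v : v \in vertices A ->
  exists2 w, w \in vertices B &
    forall F : facet A, (v \in val F) = (w \in val (f F)).
Proof.
move=> vA; have [e [e_inj us last shell]] := shelling_ranking pmA vA.
have [F0 [vF0 srcF0 minF0]] := first_source pmA e_inj vA.
have /(FRP pmB)[w wF0 fN] : FR (f F0) (f (neighbor F0 v)).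
  by rewrite f_FR; exact: FR_neighbor.
have wB := facet_vertex wF0; exists w => //.
have eh_inj : injective (e \o h) := inj_comp e_inj (can_inj hK).
have us' : unique_sources (e \o h).
  apply: (card_unique_sources pmB eh_inj).
  rewrite (card_source_pairs _ fK hK f_FR) (unique_sources_card pmA e_inj us).
  have h_FR G H : FR (h G) (h H) = FR G H by rewrite -f_FR !hK.
  exact: (card_vertices_iso pmB pmA hK fK h_FR wB).
have srcB : (f F0, neighbor (f F0) w) \in source_pairs (@FR _ B) (e \o h).
  rewrite -fN; apply/source_pairsP; split; first by rewrite f_FR;
    exact: FR_neighbor.
  move=> G; rewrite -(hK G) f_FR (can_eq fK) /= !fK.
  by case/source_pairsP: srcF0 => _; apply.
have starB F : w \in val (f F) -> v \in val F.
  move=> /(us' _ _ wF0 srcB) /=; rewrite !fK => le.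
  by apply: contraLR le => vF; rewrite -ltnNge; exact: last.
have starA n F : e F < n -> v \in val F -> w \in val (f F).
  elim: n F => // n IH F; rewrite ltnS => leFn vF.
  have := minF0 F vF; rewrite leq_eqVlt (inj_eq e_inj) => /predU1P[<- //|lt].
  have [H [FRH vH ltH]] := shell _ _ vF0 vF lt.
  have wH : w \in val (f H) by apply: IH => //; exact: leq_trans leFn.
  have [u uH fFE] : exists2 u, u \in val (f H) & f F = neighbor (f H) u.
    by apply/(FRP pmB); rewrite f_FR FR_sym.
  rewrite fFE mem_neighbor //; apply/eqP => wu.
  (* Both f F and the image of the neighbor of H across v, which starB keeps
     out of the star of w, would be the neighbor of f H across w. *)
  have [u' u'H fNE] : exists2 u', u' \in val (f H) & f (neighbor H v) =
    neighbor (f H) u'.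
    by apply/(FRP pmB); rewrite f_FR; exact: FR_neighbor.
  have [_ _ vN] := neighborP pmA vH.
  have := contra (@starB (neighbor H v)) vN;
    rewrite fNE mem_neighbor // negbK => /eqP wu'.
  have FN : F = neighbor H v by apply: (can_inj fK); rewrite fNE fFE -wu -wu'.
  by rewrite FN (negPf vN) in vF.
move=> F; apply/idP/idP; [exact: (starA (e F).+1)|exact: starB].
Qed.

Lemma vertex_map : exists phi : vertex A -> vertex B,
  forall (v : vertex A) (F : facet A), (val v \in val F) =
    (val (phi v) \in val (f F)).
Proof.
have star (v : vertex A) : exists w : vertex B,
    forall F : facet A, (val v \in val F) = (val w \in val (f F)).
  by have [w wB eqw] := star_image (valP v); exists (exist _ w wB).
by have [phi phiP] := choice star; exists phi.
Qed.

End VertexMap.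

Section Reconstruction.
Variables (V V' : finType) (A : complex V) (B : complex V').

Definition vertex_image (phi : vertex A -> vertex B) (F : {set V}) : {set V'} :=
  [set val (phi v) | v : vertex A & val v \in F].

Lemma mem_vertex_image phi (F : {set V}) v :
  injective phi -> (val (phi v) \in vertex_image phi F) = (val v \in F).
Proof.
move=> phi_inj; apply/imsetP/idP => [[u uF /val_inj/phi_inj ->]|vF];
  first by rewrite inE in uF.
by exists v; rewrite ?inE.
Qed.

Lemma face_in_facet (F : face A) : exists X : facet A, val F \subset val X.
Proof.
have [X maxX sFX] := maxset_exists (P := [in faces A]) (valP F).
have fX : X \in facets A by rewrite inE.
by exists (exist _ X fX).
Qed.

End Reconstruction.

Lemma vertex_image_face (V V' : finType) (A : complex V) (B : complex V')
    (f : facet A -> facet B) (phi : vertex A -> vertex B) :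
  (forall (v : vertex A) (F : facet A), (val v \in val F) =
    (val (phi v) \in val (f F))) ->
  exists g : face A -> face B, forall F : face A, val (g F) =
    vertex_image phi (val F).
Proof.
move=> phiP.
suff im (F : face A) : exists G : face B, val G = vertex_image phi (val F).
  by have [g gE] := choice im; exists g.
have [X sFX] := face_in_facet F.
suff fF : vertex_image phi (val F) \in faces B by exists (exist (fun G =>
  is_true (G \in faces B)) _ fF).
apply: faces_closed (facets_faces (valP (f X))).
apply/fintype.subsetP => u /imsetP[v]; rewrite inE => vF ->.
by rewrite -phiP (fintype.subsetP sFX).
Qed.

Lemma vertex_imageK (V V' : finType) (A : complex V) (B : complex V')
    (phi : vertex A -> vertex B) (psi : vertex B -> vertex A) (F : face A) :
  cancel phi psi -> cancel psi phi ->
  vertex_image psi (vertex_image phi (val F)) = val F.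
Proof.
move=> phiK psiK; apply/setP=> u; apply/imsetP/idP => [[w]|uF].
  rewrite inE -{1}(psiK w) mem_vertex_image; last exact: can_inj phiK.
  by move=> ? ->.
have uA : u \in vertices A.
  by rewrite inE; apply: faces_closed (valP F); rewrite sub1set.
exists (phi (exist _ u uA)); rewrite ?inE ?phiK //.
by rewrite mem_vertex_image //; exact: can_inj phiK.
Qed.

Theorem FR_isomorphism_extends (V V' : finType) (A : complex V) (B : complex V')
    (f : facet A -> facet B) :
  shellable_pseudomanifold A -> shellable_pseudomanifold B ->
  FR_isomorphism f ->
  exists! g : {ffun face A -> face B},
    simplicial_isomorphism g /\ extends_facet_map f g.
Proof.
move=> pmA pmB [[h fK hK] f_FR].
have h_FR G H : FR (h G) (h H) = FR G H by rewrite -f_FR !hK.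
have [phi phiP] := vertex_map pmA pmB fK hK f_FR.
have [psi psiP] := vertex_map pmB pmA hK fK h_FR.
have phiK : cancel phi psi.
  move=> v; apply/val_inj/(same_star_eq pmA (valP _)) => F.
  by rewrite -{1}(fK F) -psiP -phiP.
have psiK : cancel psi phi.
  move=> w; apply/val_inj/(same_star_eq pmB (valP _)) => G.
  by rewrite -{1}(hK G) -phiP -psiP.
have [g gE] := vertex_image_face phiP; have [k kE] := vertex_image_face psiP.
have gK : cancel g k.
  by move=> F; apply: val_inj; rewrite kE gE (vertex_imageK _ phiK psiK).
have kK : cancel k g.
  by move=> G; apply: val_inj; rewrite gE kE (vertex_imageK _ psiK phiK).
exists [ffun F => g F]; split.
  split; last first.
    move=> F; rewrite ffunE gE /=; apply/setP=> u; apply/imsetP/idP => [[v]|uF].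
      by rewrite inE phiP => ? ->.
    have uB := facet_vertex uF.
    exists (psi (exist _ u uB)); last by rewrite psiK.
    by rewrite inE phiP psiK.
  split.
  - by exists k => F; rewrite ffunE ?gK ?kK.
  - move=> F G sFG; rewrite !ffunE !gE; apply/imsetS/fintype.subsetP => v.
    by rewrite !inE; exact: (fintype.subsetP sFG).
  - exists phi; first by exists psi.
    by move=> F; rewrite ffunE gE.
move=> g' [[_ _ [phi' phi'_bij g'E]] g'f].
have eq_phi v : phi' v = phi v.
  apply/val_inj/(same_star_eq pmB (valP _)) => G;
    rewrite -(hK G) -phiP -g'f g'E.
  by rewrite [LHS](mem_vertex_image _ _ (bij_inj phi'_bij)).
apply/ffunP => F; apply: val_inj; rewrite ffunE gE g'E.
by apply: eq_imset => v; rewrite eq_phi.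
Qed.

(** * Collapsing the full simplex onto a non-spherical subword complex *)

Section Collapse.
Variable V : finType.
Implicit Types (F G s : {set V}) (K L X Y Z : {set {set V}}) (a u : V).

Inductive collapses : {set {set V}} -> {set {set V}} -> Prop :=
| collapses_refl K : collapses K K
| collapses_step s u K L :
    u \notin s -> s \in K -> u |: s \in K ->
    (forall F, F \in K -> s \subset F -> F = s \/ F = u |: s) ->
    collapses (K :\: [set s; u |: s]) L -> collapses K L.

Lemma collapses_sub K L : collapses K L -> L \subset K.
Proof.
elim=> [{}K|s u {}K {}L _ _ _ _ _ IH]; first exact: subxx.
exact: fintype.subset_trans IH (subsetDl _ _).
Qed.

Lemma collapses_trans K L X : collapses K L -> collapses L X -> collapses K X.
Proof.
elim=> // s u {}K {}L us sK usK max _ IH /IH; exact: collapses_step.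
Qed.

Definition down_closed K := forall F G, F \subset G -> G \in K -> F \in K.

Definition cone_with a K := forall F, (a |: F \in K) = (F \in K).

(** Faces outside L come in pairs that differ by a; a pair with a face of
    maximal size can be removed. *)
Lemma collapses_cone a K L : cone_with a K -> cone_with a L -> down_closed L ->
  L \subset K -> collapses K L.
Proof.
move=> coneK coneL dL; have [n] := ubnP #|K :\: L|.
elim: n K coneK => // n IH K coneK; rewrite ltnS => leK LK.
have [->|] := eqVneq K L; first exact: collapses_refl.
rewrite eqEsubset LK andbT => /subsetPn[F0 F0K F0L].
have F0P : F0 \in K :\: L by rewrite inE F0L.
case: (@arg_maxnP _ F0 (fun F => F \in K :\: L) (fun F => #|F|) F0P).
move=> F; rewrite inE => /andP[FL FK] maxF.
have coneKL G : G \in K :\: L -> a |: G \in K :\: L.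
  by rewrite !inE coneK coneL.
have aF : a \in F.
  have := maxF (a |: F) (coneKL _ _); rewrite inE FL FK => /(_ isT) /=.
  by rewrite cardsU1; case: (a \in F); rewrite // add1n ltnn.
pose s := F :\ a; have FE : F = a |: s by rewrite setD1K.
have as_ : a \notin s by rewrite !inE eqxx.
have sK : s \in K by rewrite -coneK -FE.
have sL : s \notin L by rewrite -coneL -FE.
have max G : G \in K -> s \subset G -> G = s \/ G = a |: s.
  move=> GK sG; have GL : G \notin L by apply: contra sL; exact: dL.
  have aG : a |: G = F.
    apply/esym/eqP; rewrite eqEcard {1}FE setUS //=.
    by apply: (maxF (a |: G)); apply: coneKL; rewrite inE GL.
  have [aG'|aG'] := boolP (a \in G).
    by right; rewrite -FE -aG (setUidPr _) ?sub1set.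
  by left; rewrite /s -aG setU1K.
apply: (collapses_step as_ sK _ max); first by rewrite -FE.
apply: IH.
- move=> G; rewrite !inE coneK; congr (~~ _ && _).
  have -> : (a |: G == s) = false.
    by apply: contraNF as_ => /eqP <-; rewrite setU11.
  apply/eqP/orP => [e|[]/eqP ->]; rewrite ?setUA ?setUid //.
  have [aG|aG] := boolP (a \in G).
    by right; rewrite -e (setUidPr _) ?sub1set.
  by left; rewrite -(setU1K aG) e setU1K.
- apply: leq_trans leK; apply: proper_card; apply/properP; split.
    by apply/fintype.subsetP => G; rewrite !inE => /and3P[-> _ ->].
  by exists s; rewrite !inE ?eqxx ?sL ?sK ?andbF.
- apply/fintype.subsetP => G GL; rewrite !inE (fintype.subsetP LK) // andbT.
  by apply/norP; split; apply: contraTneq GL => ->; rewrite // -FE.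
Qed.

Definition cone_over a X := [set F : {set V} | (a \in F) && (F :\ a \in X)].

(** A collapse of the base lifts to the cone with apex a, each pair being
    enlarged by a. *)
Lemma collapses_cone_over a X L Y :
  (forall F, F \in X -> a \notin F) -> (forall F, F \in Y -> a \notin F) ->
  collapses X L -> collapses (Y :|: cone_over a X) (Y :|: cone_over a L).
Proof.
move=> aX aY XL; elim: XL aX => [{}X|s u {}X {}L us sX usX max _ IH] aX.
  exact: collapses_refl.
have as_ := aX s sX.
have nau : a != u by apply: contraNneq (aX _ usX) => ->; rewrite setU11.
have delE F : a \in F -> ((F == a |: s) = (F :\ a == s)) *
                         ((F == u |: (a |: s)) = (F :\ a == u |: s)).
  move=> aF; rewrite setUCA; split; apply/eqP/eqP => [->|<-];
    rewrite ?setD1K //.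
    by rewrite setU1K.
  by rewrite setU1K // aX.
apply: (@collapses_step (a |: s) u).
- by rewrite !inE eq_sym negb_or nau.
- by rewrite !inE eqxx /= setU1K // sX orbT.
- by rewrite setUCA !inE eqxx /= setU1K ?aX // usX orbT.
- move=> F; rewrite inE subUset sub1set => /orP[/aY/negPf->//|].
  rewrite inE => /andP[aF FX] /andP[_ sF].
  have sFa : s \subset F :\ a by rewrite subsetD1 sF.
  by have [/eqP|/eqP] := max _ FX sFa; rewrite -(delE F aF) => /eqP;
    [left|right].
have -> : (Y :|: cone_over a X) :\: [set a |: s; u |: (a |: s)] =
          Y :|: cone_over a (X :\: [set s; u |: s]).
  apply/setP=> F; rewrite !inE; have [aF|aF] := boolP (a \in F).
    have FY : F \in Y = false by apply: contraTF aF => /aY.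
    by rewrite FY !delE.
  rewrite orbF andbC; case FY: (F \in Y) => //=; apply/norP.
  by split; apply: contraNneq aF => ->; rewrite !inE eqxx ?orbT.
by apply: IH => F; rewrite inE => /andP[_]; exact: aX.
Qed.

(** A collapse of Y is still one after the faces Z are added, if no face
    removed from Y lies below a face of Z. *)
Lemma collapses_union Y L Z : collapses Y L ->
  (forall s F, s \in Y -> s \notin L -> F \in Z -> ~~ (s \subset F)) ->
  collapses (Y :|: Z) (L :|: Z).
Proof.
elim=> [{}Y|s u {}Y {}L us sY usY max YL IH] YZ; first exact: collapses_refl.
have LY := collapses_sub YL.
have sL : s \notin L.
  by apply/negP => /(fintype.subsetP LY); rewrite !inE eqxx.
have sZ F : F \in Z -> ~~ (s \subset F) by exact: YZ.
apply: (collapses_step us); rewrite ?inE ?sY ?usY //.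
  by move=> F; rewrite inE => /orP[/max|/sZ/negPf->].
have -> : (Y :|: Z) :\: [set s; u |: s] = (Y :\: [set s; u |: s]) :|: Z.
  apply/setP=> F; rewrite !inE; case FZ: (F \in Z); rewrite ?orbT ?orbF //.
  rewrite andbT; apply/norP.
  by split; apply: contraNneq (sZ F FZ) => ->; rewrite ?subxx ?subsetUr.
by apply: IH => t F; rewrite inE => /andP[_]; exact: YZ.
Qed.

End Collapse.

Lemma subset_setU1_notin (T : finType) (a : T) (A B : {set T}) :
  a \notin A -> (A \subset a |: B) = (A \subset B).
Proof. by move=> aA; rewrite -subDset (setDidPl _) // disjoint_sym disjoints1.
  Qed.

Section PrefixComplex.
Local Open Scope group_scope.
Variables (W : finGroupType) (S : {set W}) (cox : coxeter_system S).
Variables (r : nat) (Q : r.-tuple W) (QS : {subset Q <= S}).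
Implicit Types (I J F G H : {set 'I_r}) (p j : 'I_r) (x : W).
Local Notation q := (tnth Q).
Local Notation subprod := (subprod Q).
Local Notation dem := (prefix_demazure S Q).

Definition initial k : {set 'I_r} := [set i : 'I_r | i < k].

(** The subword complex of the first k letters, realized on the positions of
    the full word so that the induction on k does not change the ground set. *)
Definition prefix_facet k x I :=
  [&& I \subset initial k, subprod (initial k :\: I) == x
    & #|initial k :\: I| == len S x].

Definition prefix_faces k x : {set {set 'I_r}} :=
  [set F : {set 'I_r} | [exists I : {set 'I_r}, (F \subset I) &&
    prefix_facet k x I]].

Lemma prefix_facesP k x F :
  reflect (exists2 I : {set 'I_r}, F \subset I &
    prefix_facet k x I) (F \in prefix_faces k x).
Proof.
rewrite inE; apply: (iffP existsP) => [[I /andP[]]|[I FI fI]]; exists I => //.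
by rewrite FI.
Qed.

Lemma prefix_faces_down k x : down_closed (prefix_faces k x).
Proof.
move=> F G FG /prefix_facesP[I GI fI]; apply/prefix_facesP; exists I => //.
exact: fintype.subset_trans GI.
Qed.

Lemma prefix_faces_prefix k x F : F \in prefix_faces k x -> F \subset initial k.
Proof. by case/prefix_facesP => I FI /and3P[/(fintype.subset_trans FI)]. Qed.

Lemma prefixS p : initial p.+1 = p |: initial p.
Proof. by apply/setP=> i; rewrite !inE ltnS leq_eqVlt. Qed.

Lemma notin_prefix p F : F \subset initial p -> p \notin F.
Proof. by move=> /fintype.subsetP Fp; apply/negP => /Fp; rewrite inE ltnn. Qed.

Lemma subprod_last p J : J \subset initial p ->
  subprod (p |: J) = subprod J * q p.
Proof.
move=> Jp; have bJ : below_pos J p = J.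
  apply/setP=> i; rewrite !inE; case iJ: (i \in J) => //=.
  by have := fintype.subsetP Jp i iJ; rewrite inE.
have -> : p |: J = below_pos (p |: J) p.+1.
  apply/setP=> i; rewrite !inE ltnS; case: eqVneq => [->|] /=;
    first by rewrite leqnn.
  by case iJ: (i \in J) => //=; have := fintype.subsetP Jp i iJ;
    rewrite inE => /ltnW ->.
rewrite subprod_belowS setU11; congr (subprod _ * _).
apply/setP=> i; rewrite -bJ !inE; case: eqVneq => [->|_] /=.
  by rewrite ltnn andbF.
by rewrite -andbA andbb.
Qed.

Lemma prefix_facet_cone p x I : p \notin I ->
  prefix_facet p.+1 x (p |: I) = prefix_facet p x I.
Proof.
move=> pI; rewrite /prefix_facet prefixS.
have -> : (p |: initial p) :\: (p |: I) = initial p :\: I.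
  apply/setP=> i; rewrite !inE; case: eqVneq => [->|] //=.
  by rewrite ltnn andbF.
congr (_ && _); apply/idP/idP => [|/(setUS [set p])//].
rewrite subUset => /andP[_ /fintype.subsetP sI]; apply/fintype.subsetP=> i iI.
have := sI i iI; rewrite !inE => /predU1P[ip|//].
by rewrite -ip iI in pI.
Qed.

Lemma prefix_facet_delete p x I : p \notin I -> len S (x * q p) < len S x ->
  prefix_facet p.+1 x I = prefix_facet p (x * q p) I.
Proof.
move=> pI lt; rewrite /prefix_facet prefixS.
have qS := letterS QS p; have qq := generator_mulxx cox qS.
have -> : (I \subset p |: initial p) = (I \subset initial p).
  exact: subset_setU1_notin.
case Ip: (I \subset initial p) => //=.
have -> : (p |: initial p) :\: I = p |: (initial p :\: I).
  by apply/setP=> i; rewrite !inE; case: eqVneq => [->|] //=; rewrite pI.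
rewrite subprod_last ?subsetDl // cardsU1 !inE ltnn andbF /= add1n.
have -> : len S x = (len S (x * q p)).+1.
  by apply/eqP; rewrite eqn_leq lt (len_mulrV cox _ qS).
rewrite eqSS; congr (_ && _).
by rewrite -(inj_eq (mulIg (q p)) _ x) -mulgA qq mulg1.
Qed.

(** When the last letter lengthens x, no reduced word of x ends with it. *)
Lemma prefix_facet_up p x I : len S x < len S (x * q p) ->
  prefix_facet p.+1 x I -> p \in I.
Proof.
move=> lt /and3P[Ip /eqP eI /eqP cI]; apply: contraTT lt => pI.
have qq := generator_mulxx cox (letterS QS p).
move: eI cI.
have -> : initial p.+1 :\: I = p |: (initial p :\: I).
  by rewrite prefixS; apply/setP=> i; rewrite !inE; case: eqVneq => [->|] //=;
    rewrite pI.
rewrite subprod_last ?subsetDl // cardsU1 !inE ltnn andbF /= add1n => <- <-.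
rewrite -mulgA qq mulg1 -leqNgt; apply: leq_trans (len_subprod cox QS _) _.
exact: leqnSn.
Qed.

(** The exchange property removes a letter from a reduced word of x and leaves
    one of x q_p. *)
Lemma prefix_link_sub_deletion p x : len S (x * q p) < len S x ->
  prefix_faces p x \subset prefix_faces p (x * q p).
Proof.
move=> lt; apply/fintype.subsetP => F /prefix_facesP[I FI /and3P[Ip /eqP eI
  /eqP cI]].
have qS := letterS QS p.
have rt : reflection S (q p ^ x^-1) by exact: reflection_generator.
have [|j jJ ej] := letter_refl_exchange cox QS rt (J := initial p :\: I).
  by rewrite eI -conjgCV.
have jI : j \notin I by move: jJ; rewrite inE => /andP[].
have jp : j \in initial p by move: jJ; rewrite inE => /andP[].
apply/prefix_facesP; exists (j |: I); first by rewrite subsetU // FI orbT.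
have -> : prefix_facet p (x * q p) (j |: I) = true; last by [].
have JE : initial p :\: (j |: I) = (initial p :\: I) :\ j.
  by apply/setP=> i; rewrite !inE negb_or andbA.
apply/and3P; split; first by rewrite subUset sub1set jp.
  by rewrite JE -(letter_refl_del cox QS) // ej eI -conjgCV.
rewrite JE -eqSS; have := cardsD1 j (initial p :\: I).
rewrite jJ cI add1n => <-; rewrite eqn_leq lt andbT.
exact: len_mulrV.
Qed.

Lemma prefix_faces_cone p x F :
  p \in F -> (F \in prefix_faces p.+1 x) = (F :\ p \in prefix_faces p x).
Proof.
move=> pF; apply/prefix_facesP/prefix_facesP => -[I FI fI].
  have pI := fintype.subsetP FI p pF; exists (I :\ p); first exact: setSD.
  by rewrite -prefix_facet_cone ?setD1K // !inE eqxx.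
have pI : p \notin I by case/and3P: fI => /notin_prefix.
exists (p |: I); last by rewrite prefix_facet_cone.
by rewrite -(setD1K pF) setUS.
Qed.

Lemma prefix_faces_delete p x : len S (x * q p) < len S x ->
  prefix_faces p.+1 x =
  prefix_faces p (x * q p) :|: cone_over p (prefix_faces p x).
Proof.
move=> lt; apply/setP=> F; rewrite [RHS]inE [in X in _ || X]inE.
have [pF|pF] /= := boolP (p \in F).
  rewrite -prefix_faces_cone //; apply/esym/orb_idl => /prefix_faces_prefix.
  by move/notin_prefix; rewrite pF.
rewrite orbF; apply/idP/idP => /prefix_facesP[I FI fI]; last first.
  apply/prefix_facesP; exists I => //; rewrite prefix_facet_delete //.
  by case/and3P: fI => /notin_prefix.
have [pI|pI] := boolP (p \in I); last first.
  by apply/prefix_facesP; exists I => //; rewrite -prefix_facet_delete.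
apply: (fintype.subsetP (prefix_link_sub_deletion lt)).
apply/prefix_facesP; exists (I :\ p); first by rewrite subsetD1 FI.
by rewrite -prefix_facet_cone ?setD1K // !inE eqxx.
Qed.

Lemma powerset_prefixS p : powerset (initial p.+1) =
  powerset (initial p) :|: cone_over p (powerset (initial p)).
Proof.
apply/setP=> F; rewrite !inE prefixS.
have [pF|pF] /= := boolP (p \in F).
  rewrite -subDset orb_idl // => /notin_prefix; by rewrite pF.
by rewrite orbF subset_setU1_notin.
Qed.

(** If the last letter lengthens x, the complex is a cone over it. Otherwise it
    is the union of its deletion and the cone over its link, and the Demazure
    product of the shorter word is neither x q_p nor x, the elements that
    define these two complexes. The cone over the simplex of the first k
    positions first shrinks to the cone over the link, then the simplex itself
    to the deletion, which contains the link. A void link is reached as well,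
    since the simplex is then a cone over any of its vertices. *)
Lemma prefix_faces_collapse k x : k <= r -> dem k != x ->
  prefix_faces k x != set0 ->
  collapses (powerset (initial k)) (prefix_faces k x).
Proof.
elim: k x => [|k IH] x kr.
  have p0 : initial 0 = set0 by apply/setP=> i; rewrite !inE ltn0.
  move=> + /set0Pn[F /prefix_facesP[I _ /and3P[_ + _]]].
  by rewrite p0 set0D subprod0 /prefix_demazure take0 => /negPf ->.
pose p := Ordinal kr; rewrite (prefix_demazureS S Q p) -[k.+1]/(p.+1).
have qS := letterS QS p; have qq := generator_mulxx cox qS.
have xqq : x * q p * q p = x by rewrite -mulgA qq mulg1.
have [lt|] := ltnP (len S x) (len S (x * q p)).
  move=> _ _; apply: (@collapses_cone _ p).
  - by move=> F; rewrite !inE subUset sub1set inE ltnSn.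
  - move=> F; apply/prefix_facesP/prefix_facesP => -[I FI fI]; exists I => //.
      by apply: fintype.subset_trans FI; exact: subsetUr.
    by rewrite subUset sub1set (prefix_facet_up lt fI).
  - exact: prefix_faces_down.
  - by apply/fintype.subsetP => F; rewrite [in X in _ -> X]inE;
    exact: prefix_faces_prefix.
rewrite leq_eqVlt (negPf (len_mulr_neq cox _ qS)) /= => lt demx ne.
have notp (F : {set 'I_r}) : F \in powerset (initial p) -> p \notin F.
  by rewrite inE; exact: notin_prefix.
have dem_x : dem k != x.
  by apply: contraNneq demx => ->; rewrite /demazure_step ltnNge ltnW.
have dem_xq : dem k != x * q p.
  by apply: contraNneq demx => ->; rewrite /demazure_step xqq lt.
rewrite -[k.+1]/(p.+1) in ne *.
rewrite prefix_faces_delete // powerset_prefixS.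
rewrite prefix_faces_delete // in ne.
have link_sub := prefix_link_sub_deletion lt.
have del_ne : prefix_faces p (x * q p) != set0.
  case/set0Pn: ne => F; rewrite !inE => /orP[FD|/andP[_ FL]]; apply/set0Pn.
    by exists F; rewrite inE.
  by exists (F :\ p); apply: (fintype.subsetP link_sub); rewrite inE.
have link_collapse : collapses (powerset (initial p)) (prefix_faces p x).
  have [L0|] := eqVneq (prefix_faces p x) set0; last first.
    by move=> Lne; apply: IH => //; exact: ltnW.
  have [/set0Pn[a ap]|/negPn/eqP p0] := boolP (initial p != set0).
    rewrite L0; apply: (@collapses_cone _ a).
    - by move=> F; rewrite !inE subUset sub1set ap.
    - by move=> F; rewrite !inE.
    - by move=> F G; rewrite !inE.
    - exact: sub0set.
  exfalso; case/set0Pn: del_ne => F /prefix_facesP[I _ /and3P[_ + _]].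
  rewrite p0 set0D subprod0 => /eqP xq1; case/negP: dem_xq.
  have k0 : k = 0.
    apply/eqP; rewrite -leqn0 leqNgt; apply/negP => k_gt0.
    have : Ordinal (leq_ltn_trans (leq0n k) kr) \in initial p by rewrite inE.
    by rewrite p0 inE.
  by rewrite k0 /prefix_demazure take0 -xq1.
apply: collapses_trans.
  exact: (collapses_cone_over notp notp link_collapse).
apply: collapses_union.
  by apply: IH => //; exact: ltnW.
move=> s F; rewrite inE => sp sD; rewrite inE => /andP[pF FL].
apply: contra sD => sF; apply: (fintype.subsetP link_sub).
apply: prefix_faces_down FL; rewrite subsetD1 sF /=; exact: notin_prefix.
Qed.

End PrefixComplex.

(** * A parity theorem for labelings of a cubical grid *)

Lemma big_addb_symmetric (I : finType) (P : rel I) (f : I -> I -> bool) :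
  symmetric P -> irreflexive P -> (forall i j, P i j -> f i j = f j i) ->
  \big[addb/false]_i \big[addb/false]_(j | P i j) f i j = false.
Proof.
move=> symP irrP symf; rewrite pair_big_dep /=.
pose rk (p : I * I) := (enum_rank p.1 < enum_rank p.2)%N.
rewrite (bigID rk) /= [X in _ (+) X](reindex_inj (h := fun p =>
  (p.2, p.1))) /=; last first.
  by move=> [i j] [i' j'] [-> ->].
rewrite (eq_big (fun p => P p.1 p.2 && rk p) (fun p => f p.1 p.2)) //.
  set s := bigop _ _ _; rewrite -[RHS](addbb s); congr (_ (+) _).
  apply: eq_big => [[i j]|[i j]] /=; last by case/andP => /symf.
  rewrite symP /rk /= -leqNgt leq_eqVlt; case: eqP =>
    //= /val_inj/enum_rank_inj ->.
  by rewrite irrP.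
Qed.

(** A cochain with values mod 2 assigns a value to a cube given by its lowest
    vertex and its set of directions. Degrees are not recorded: a cochain of
    degree d is a function whose values at sets of d directions matter. *)
Section CubicalCochains.
Variables n m : nat.
Local Notation point := {ffun 'I_n -> 'I_m.+1}.
Local Notation cochain := (point -> {set 'I_n} -> bool).
Implicit Types (x y : point) (E : {set 'I_n}) (i j l : 'I_n) (C : cochain).

(** Steps wrap around at the end of the grid, so that they are bijective. *)
Definition grid_step x i : point := [ffun j =>
  if j == i then ordS (x j) else x j].

Definition grid_unstep x i : point := [ffun j =>
  if j == i then ord_pred (x j) else x j].

Lemma grid_stepK i : cancel (grid_step^~ i) (grid_unstep^~ i).
Proof. by move=> x; apply/ffunP=> j; rewrite !ffunE; case: eqP => // _;
  rewrite ordSK. Qed.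

Lemma grid_step_comm x i j : grid_step (grid_step x i) j =
  grid_step (grid_step x j) i.
Proof. by apply/ffunP=> l; rewrite !ffunE; case: eqP; case: eqP. Qed.

Lemma grid_step_other x i j : j != i -> grid_step x i j = x j.
Proof. by move=> /negPf nji; rewrite ffunE nji. Qed.

Lemma grid_step_val x i : x i < m -> grid_step x i i = (x i).+1 :> nat.
Proof. by move=> lt; rewrite ffunE eqxx /= modn_small. Qed.

Definition coboundary C : cochain := fun x E =>
  \big[addb/false]_(i in E) (C (grid_step x i) (E :\ i) (+) C x (E :\ i)).

(** The cup products of C with the labeling a and with its coboundary. *)
Definition cup0 (a : point -> bool) C : cochain := fun x E => a x && C x E.

Definition cup1 (a : point -> bool) C : cochain := fun x E =>
  \big[addb/false]_(i in E) ((a (grid_step x i) (+) a x) &&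
    C (grid_step x i) (E :\ i)).

(** Leibniz rule. *)
Lemma coboundary_cup0 a C x E :
  coboundary (cup0 a C) x E = cup1 a C x E (+) (a x && coboundary C x E).
Proof.
rewrite /coboundary /cup1 /cup0 big_distrr /= -big_split /=.
apply: eq_bigr => i _.
by case: (a x); case: (a _); case: (C _ _); case: (C _ _).
Qed.

Lemma coboundaryK C x E : coboundary (coboundary C) x E = false.
Proof.
rewrite /coboundary.
pose f i j := C (grid_step (grid_step x i) j) (E :\ i :\ j) (+)
  C (grid_step x i) (E :\ i :\ j)
   (+) (C (grid_step x j) (E :\ i :\ j) (+) C x (E :\ i :\ j)).
rewrite (eq_bigr (fun i => \big[addb/false]_(j in E :\ i) f i j)); last first.
  by move=> i _; rewrite -big_split.
rewrite big_mkcond.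
rewrite (eq_bigr (fun i => \big[addb/false]_(j | [&& i != j, i \in E &
  j \in E]) f i j)).
  apply: big_addb_symmetric => [i j|i|i j _]; rewrite ?eqxx //.
    by rewrite eq_sym; congr (_ && _); rewrite andbC.
  rewrite /f grid_step_comm.
  have -> : E :\ i :\ j = E :\ j :\ i by rewrite !setDDl setUC.
  by rewrite -!addbA; congr (_ (+) _); rewrite addbCA.
move=> i _; case: ifP => iE.
  by apply: eq_bigl => j; rewrite !inE eq_sym.
by rewrite big_pred0 // => j; rewrite andbF.
Qed.

Variable a : 'I_n -> point -> bool.

(** The cup product of the coboundaries of the last k labelings a_(n-k), ...,
    a_(n-1). *)
Fixpoint cup_from (k : nat) : cochain :=
  if k is k'.+1 then
    fun x E => if insub (n - k) is Some i then cup1 (a i)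
      (cup_from k') x E else false
  else fun _ _ => true.

Lemma eq_coboundary C C' : (forall x E, C x E = C' x E) ->
  forall x E, coboundary C x E = coboundary C' x E.
Proof. by move=> CC' x E; apply: eq_bigr => i _; rewrite !CC'. Qed.

Lemma cup_fromS k (lt : n - k.+1 < n) x E :
  cup_from k.+1 x E = cup1 (a (Ordinal lt)) (cup_from k) x E.
Proof. by rewrite /= insubT. Qed.

Lemma cup_from_coboundary k (lt : n - k.+1 < n) x E :
  (forall x E, coboundary (cup_from k) x E = false) ->
  cup_from k.+1 x E = coboundary (cup0 (a (Ordinal lt)) (cup_from k)) x E.
Proof.
by move=> cocycle; rewrite coboundary_cup0 cocycle andbF addbF cup_fromS.
Qed.

Lemma cup_from_cocycle k x E : k <= n -> coboundary (cup_from k) x E = false.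
Proof.
elim: k x E => [|k IH] x E kn; first by rewrite /coboundary big1.
have lt : n - k.+1 < n by lia.
rewrite (eq_coboundary (C' := coboundary (cup0 (a (Ordinal lt)) (cup_from k)))).
  exact: coboundaryK.
by move=> y F; apply: cup_from_coboundary => z G; apply: IH; exact: ltnW.
Qed.

(** Cubes are given by their lowest vertices. Setting the other coordinates to
    m makes grid_box (E minus j) one end of the columns in direction j. *)
Definition grid_box E x := [forall i, if i \in E then x i < m else x i ==
  m :> nat].

Definition grid_box_off E j x :=
  [forall i, (i != j) ==> if i \in E then x i < m else x i == m :> nat].

Lemma grid_box_in E j x : j \in E -> grid_box E x =
  grid_box_off E j x && (x j != m :> nat).
Proof.
move=> jE; have xj : (x j != m :> nat) = (x j < m) by have := ltn_ord (x j);
  lia.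
rewrite xj; apply/forallP/andP => [fx|[/forallP fx lt] i].
  split; last by have := fx j; rewrite jE.
  by apply/forallP => i; apply/implyP.
by have [->|nij] := eqVneq i j; [rewrite jE|have := fx i; rewrite nij].
Qed.

Lemma grid_box_out E j x : j \in E ->
  grid_box (E :\ j) x = grid_box_off E j x && (x j == m :> nat).
Proof.
move=> jE; apply/forallP/andP => [fx|[/forallP fx /eqP e] i].
  split; last by have := fx j; rewrite !inE eqxx.
  by apply/forallP => i; apply/implyP => nij; have := fx i; rewrite !inE nij.
have [->|nij] := eqVneq i j; first by rewrite !inE eqxx /= e.
by have := fx i; rewrite !inE nij.
Qed.

(** The sum telescopes along direction j. *)
Lemma stokes_direction (g : point -> bool) E j : j \in E ->
  \big[addb/false]_(x | grid_box E x) (g (grid_step x j) (+) g x) =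
  \big[addb/false]_(x | grid_box (E :\ j) x) g x (+)
  \big[addb/false]_(x | grid_box_off E j x && (x j == 0 :> nat)) g x.
Proof.
move=> jE; rewrite big_split /=.
rewrite !(eq_bigl _ _ (fun x => grid_box_in x jE)).
rewrite [RHS](_ : _ = \big[addb/false]_(x | grid_box_off E j x && (x j ==
  m :> nat)) g x (+)
  \big[addb/false]_(x | grid_box_off E j x && (x j == 0 :> nat)) g x);
    last first.
  by congr (_ (+) _); apply: eq_bigl => x; rewrite grid_box_out.
have -> : \big[addb/false]_(x | grid_box_off E j x &&
  (x j != m :> nat)) g (grid_step x j) =
          \big[addb/false]_(x | grid_box_off E j x && (x j != 0 :> nat)) g x.
  rewrite [RHS](reindex_inj (can_inj (grid_stepK j))) /=; apply: eq_bigl => x.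
  congr (_ && _).
    by apply: eq_forallb => i; case: eqVneq => //= nij; rewrite grid_step_other.
  rewrite ffunE eqxx /=; have := ltn_ord (x j); rewrite ltnS leq_eqVlt.
  by case/predU1P => [->|lt]; rewrite ?modnn ?eqxx // modn_small // ltn_eqF.
have : \big[addb/false]_(x | grid_box_off E j x && (x j == 0 :> nat)) g x (+)
       \big[addb/false]_(x | grid_box_off E j x && (x j != 0 :> nat)) g x =
       \big[addb/false]_(x | grid_box_off E j x && (x j == m :> nat)) g x (+)
       \big[addb/false]_(x | grid_box_off E j x && (x j != m :> nat)) g x.
  rewrite -(bigID (fun x : point => x j == 0 :> nat)).
  by rewrite -(bigID (fun x : point => x j == m :> nat)).
by do 4 case: (bigop _ _ _).
Qed.

Hypothesis a_lo : forall i x, x i = 0 :> nat -> a i x = false.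
Hypothesis a_hi : forall i x, x i = m :> nat -> a i x = true.

(** On a face of the grid orthogonal to direction j the labeling a_j is
    constant, so its coboundary vanishes. *)
Lemma cup_from_vanish k x E j : k <= n -> n - k <= j -> j \notin E ->
  x j = 0 :> nat \/ x j = m :> nat -> cup_from k x E = false.
Proof.
elim: k x E => [|k IH] x E kn jk jE xj.
  by have := ltn_ord j; lia.
have lt : n - k.+1 < n by lia.
rewrite cup_fromS /cup1 big1 // => l lE.
have nlj : j != l by apply: contraNneq jE => ->.
have xlj : grid_step x l j = x j by rewrite grid_step_other.
have [ji|ji] := eqVneq j (Ordinal lt).
  rewrite -ji (_ : a j (grid_step x l) = a j x) ?addbb //.
  by case: xj => e; [rewrite !a_lo ?xlj|rewrite !a_hi ?xlj].
rewrite (IH (grid_step x l)) ?andbF ?xlj //; first exact: ltnW.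
  by move: ji; rewrite -val_eqE /=; lia.
by rewrite !inE (negPf jE) andbF.
Qed.

Definition directions k : {set 'I_n} := [set i : 'I_n | n - k <= i].

(** By Stokes' formula the sum over the grid of the last k + 1 directions is a
    sum over its facets. Only the facet on which the first of these coordinates
    is m contributes: there the first labeling is 1, and what remains is the
    sum for k. *)
Lemma cup_from_sum k : k <= n ->
  \big[addb/false]_(x | grid_box (directions k) x) cup_from k x
    (directions k) = true.
Proof.
elim: k => [|k IH] kn.
  have D0 i : (i \in directions 0) = false by rewrite inE subn0 leqNgt ltn_ord.
  rewrite (eq_bigl (pred1 [ffun=> ord_max])) ?big_pred1_eq // => x.
  apply/forallP/eqP => [fx|-> i]; last by rewrite D0 ffunE /=.
  by apply/ffunP=> i; apply/val_inj; have := fx i; rewrite D0 ffunE => /eqP.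
have lt : n - k.+1 < n by lia.
pose i := Ordinal lt; set D := directions k.+1.
have iD : i \in D by rewrite inE /=.
have Di : D :\ i = directions k.
  by apply/setP=> j; rewrite !inE -val_eqE /=; lia.
have cocycle y F : coboundary (cup_from k) y F = false.
  by apply: cup_from_cocycle; exact: ltnW.
under eq_bigr do rewrite (cup_from_coboundary lt) //.
rewrite /coboundary exchange_big /=.
rewrite (eq_bigr (fun j => \big[addb/false]_(x | grid_box (D :\ j) x)
     cup0 (a i) (cup_from k) x (D :\ j) (+)
  \big[addb/false]_(x | grid_box_off D j x && (x j == 0 :> nat))
     cup0 (a i) (cup_from k) x (D :\ j))); last first.
  by move=> j jD; rewrite -stokes_direction.
rewrite (bigD1 i iD) /= [X in _ (+) X]big1; last first.
  move=> j /andP[jD0 nji]; have jD : j \in D := jD0.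
  have jk : n - k <= j by move: jD nji; rewrite inE -val_eqE /=; lia.
  have van x : x j = 0 :> nat \/ x j = m :> nat ->
      cup0 (a i) (cup_from k) x (D :\ j) = false.
    move=> xj; rewrite /cup0 (cup_from_vanish _ jk _ xj) ?andbF //;
      first exact: ltnW.
    by rewrite !inE eqxx.
  rewrite !big1 // => x; first by case/andP => _ /eqP xj; apply: van; left.
  by rewrite grid_box_out // => /andP[_ /eqP xj]; apply: van; right.
rewrite addbF [X in _ (+) X]big1 ?addbF; last first.
  by move=> x /andP[_ /eqP xi]; rewrite /cup0 a_lo.
rewrite Di -[RHS](IH (ltnW kn)); apply: eq_bigr => x;
  rewrite -Di grid_box_out //.
by case/andP=> _ /eqP xi; rewrite /cup0 a_hi.
Qed.

Definition in_cube x E y := forall l, x l <= y l <= x l + (l \in E).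

Lemma cup_from_sign_change k x E : k <= n -> (forall l, l \in E -> x l < m) ->
  cup_from k x E -> forall j : 'I_n, n - k <= j ->
  exists y y', [/\ in_cube x E y, in_cube x E y' & a j y != a j y'].
Proof.
elim: k x E => [|k IH] x E kn xE.
  by move=> _ j; have := ltn_ord j; lia.
have lt : n - k.+1 < n by lia.
rewrite cup_fromS => cup j jk.
have [l lE /andP[ch cup']] : exists2 l, l \in E &
    (a (Ordinal lt) (grid_step x l) (+) a (Ordinal lt) x) &&
      cup_from k (grid_step x l) (E :\ l).
  apply/exists_inP; apply: contraTT cup; rewrite negb_exists_in =>
    /forall_inP no.
  by rewrite /cup1 big1 // => l lE; apply/negbTE/no.
have cube y : in_cube (grid_step x l) (E :\ l) y -> in_cube x E y.
  move=> cy h; have := cy h; rewrite !inE; have [->|nhl] := eqVneq h l.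
    by rewrite grid_step_val ?xE // lE /=; lia.
  by rewrite grid_step_other.
have [->|ji] := eqVneq j (Ordinal lt).
  exists (grid_step x l), x; split; last by case: (a _ _) ch; case: (a _ _).
    by apply: cube => h; rewrite leqnn leq_addr.
  by move=> h; rewrite leqnn leq_addr.
have [|||y [y' [cy cy' ay]]] := IH (grid_step x l) (E :\ l) _ _ cup' j.
- exact: ltnW.
- by move=> h; rewrite !inE => /andP[nhl hE]; rewrite grid_step_other // xE.
- by move: ji; rewrite -val_eqE /=; lia.
by exists y, y'; split=> //; exact: cube.
Qed.

Lemma cube_sign_change : exists x : point, (forall l, x l < m) /\
  forall j, exists y y', [/\ in_cube x [set: 'I_n] y, in_cube x [set: 'I_n] y' &
                            a j y != a j y'].
Proof.
have DT : directions n = [set: 'I_n] by apply/setP=> i; rewrite !inE subnn.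
have [x /andP[fx cup]] : exists x, grid_box [set: 'I_n] x &&
  cup_from n x [set: 'I_n].
  apply/existsP; apply: contraT; rewrite negb_exists => /forallP no.
  have := cup_from_sum (leqnn n); rewrite DT big1 // => x fx.
  by have := no x; rewrite fx => /negbTE.
have lt l : x l < m by have /forallP/(_ l) := fx; rewrite inE.
exists x; split=> // j; apply: (cup_from_sign_change (leqnn n)) => //.
by rewrite subnn.
Qed.

End CubicalCochains.

(** * Collapses realized by retractions *)

From mathcomp Require Import classical_sets topology normedtype realfun.
From mathcomp Require Import ring lra.
Import Order.TTheory GRing.Theory Num.Theory.
Import numFieldNormedType.Exports.

Section RowLimits.
Local Open Scope classical_set_scope.
Local Open Scope ring_scope.

Lemma cvg_row (K : topologicalType) n (T : Type) (F : set_system T)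
    {FF : Filter F} (f : T -> 'rV[K]_n) (l : 'rV[K]_n) :
  (forall i, (fun t => f t 0 i) @ F --> l 0 i) -> f @ F --> l.
Proof.
move=> fl A [P lP PA]; have : \forall t \near F, forall i, P 0 i (f t 0 i).
  by apply: filter_forall => i; apply: fl; exact: lP.
apply: filterS => t Pt; apply: PA => i j; rewrite ord1; exact: Pt.
Qed.

Lemma continuous_row (X : topologicalType) (K : topologicalType) n
    (f : X -> 'rV[K]_n) :
  (forall i, continuous (fun x => f x 0 i)) -> continuous f.
Proof. by move=> fc x; apply: cvg_row => i; exact: fc. Qed.

End RowLimits.

Section Realization.
Local Open Scope ring_scope.
Variables (R : realType) (V : finType).
Implicit Types (x : 'rV[R]_#|V|) (s F : {set V}) (K L : {set {set V}}).

Local Notation coord x v := (x 0 (enum_rank v)).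

Definition support x : {set V} := [set v | coord x v != 0].

Definition realization K : set 'rV[R]_#|V| :=
  fun x => [/\ forall i, 0 <= x 0 i, \sum_i x 0 i = 1 & support x \in K].

Lemma sum_coord x : \sum_i x 0 i = \sum_v coord x v.
Proof. by rewrite (reindex enum_rank) //; exact: onW_bij (enum_rank_bij V). Qed.

Lemma realization_le1 K x v : realization K x -> coord x v <= 1.
Proof.
case=> x_ge0 + _; rewrite sum_coord (bigD1 v) //= => <-.
by rewrite lerDl sumr_ge0.
Qed.

Variables (s : {set V}) (u : V).

(** The default 1 is harmless, since weights are at most 1 and s is nonempty. *)
Definition min_weight x : R := \big[Order.min/1]_(v in s) coord x v.

(** The retraction of an elementary collapse with free face s and apex u:
    subtract the smallest weight of s from all its vertices and move the mass
    to u. *)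
Definition push_weight x : 'rV[R]_#|V| :=
  \row_i (x 0 i - (enum_val i \in s)%:R * min_weight x
          + (enum_val i == u)%:R * #|s|%:R * min_weight x).

Lemma push_weightE x v : coord (push_weight x) v =
  coord x v - (v \in s)%:R * min_weight x + (v ==
    u)%:R * #|s|%:R * min_weight x.
Proof. by rewrite mxE enum_rankK. Qed.

Lemma min_weight_continuous : continuous min_weight.
Proof.
rewrite /min_weight; elim: (index_enum V) => [|v l IH].
  under eq_fun do rewrite big_nil.
  by move=> x; apply: cst_continuous.
under eq_fun do rewrite big_cons.
case: (v \in s) => // x; apply: continuous_min; last exact: IH.
exact: coord_continuous.
Qed.

Lemma push_weight_continuous : continuous push_weight.
Proof.
apply: continuous_row => i.
under eq_fun do rewrite mxE.
have c : continuous (fun x : 'rV[R]_#|V| => x 0 i) := @coord_continuous R 1 _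
  0 i.
have cm (k : R) : continuous (fun x : 'rV[R]_#|V| => k * min_weight x).
  by move=> x; exact: (cvgM (cvg_cst k) (@min_weight_continuous x)).
by move=> x; exact: (cvgD (cvgB (c x) (cm _ x)) (cm _ x)).
Qed.

Hypotheses (us : u \notin s) (s0 : s != finset.set0).

Lemma sum_push_weight x : \sum_i push_weight x 0 i = \sum_i x 0 i.
Proof.
rewrite !sum_coord.
under eq_bigr do rewrite push_weightE.
rewrite big_split sumrB /= -!mulr_suml -natr_sum.
have -> : (\sum_v (v == u)%:R : R) = 1.
  by rewrite (bigD1 u) //= eqxx big1 ?addr0 // => v /negPf->.
rewrite (_ : (\sum_v (v \in s) = #|s|)%N); first by ring.
by rewrite -sum1_card [RHS]big_mkcond.
Qed.

Lemma push_weight_id K x : realization K x -> ~~ (s \subset support x) ->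
  push_weight x = x.
Proof.
move=> Kx /fintype.subsetPn[v vs]; rewrite inE negbK => /eqP xv0.
suff m0 : min_weight x = 0 by apply/rowP => i;
  rewrite mxE m0 !mulr0 subr0 addr0.
case: Kx => x_ge0 _ _; apply/eqP; rewrite eq_le; apply/andP; split.
  by rewrite -xv0 /min_weight bigmin_le_cond.
by apply/bigmin_geP; split.
Qed.

Lemma realization_push_weight K x : down_closed K -> u |: s \in K ->
  (forall F, F \in K -> s \subset F -> F = s \/ F = u |: s) ->
  realization K x -> realization (K :\: [set s; u |: s]%SET) (push_weight x).
Proof.
move=> dK usK max Kx; have [ssx|nsx] := boolP (s \subset support x); last first.
  rewrite (push_weight_id Kx nsx); case: Kx => x_ge0 x1 xK; split=> //.
  rewrite !inE xK andbT; apply/norP; split; apply: contraNneq nsx => ->.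
    exact: subxx.
  exact: finset.subsetUr.
have [v0 v0s] := finset.set0Pn _ s0; have [x_ge0 x1 xK] := Kx.
have [v vs mE] : exists2 v, v \in s & min_weight x = coord x v.
  rewrite /min_weight; have [||v vs ->] := @eq_bigmin _ _ _ 1 v0 (mem s)
    (fun v => coord x v).
  - exact: v0s.
  - by move=> w _; exact: realization_le1 Kx.
  - by exists v.
have m_ge0 : 0 <= min_weight x by rewrite mE.
have supp_us : support x \subset u |: s.
  by have [->|->] := max _ xK ssx; rewrite ?finset.subsetUr.
have nvu : v != u by apply: contraTneq vs => ->.
have vpush : v \notin support (push_weight x).
  by rewrite inE negbK push_weightE vs (negPf nvu) mE mul1r !mul0r subrr addr0.
split; last 1 first.
- rewrite !inE; apply/andP; split.
    apply/norP; split; apply: contraNneq vpush => ->; rewrite ?inE vs ?orbT //.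
  apply: dK usK; apply/fintype.subsetP => w; apply: contraLR => wus.
  have ws : w \notin s by apply: contra wus => ws; rewrite inE ws orbT.
  have wu : w != u by apply: contraNneq wus => ->; rewrite !inE eqxx.
  have : w \notin support x by apply: contra wus;
    exact: (fintype.subsetP supp_us).
  by rewrite !inE !negbK push_weightE (negPf ws) (negPf wu) !mul0r subr0 addr0.
- move=> i; rewrite -(enum_valK i); move: (enum_val i) => w.
  rewrite push_weightE addr_ge0 // ?mulr_ge0 ?ler0n // subr_ge0.
  case ws: (w \in s); rewrite ?mul0r // mul1r.
  by rewrite /min_weight bigmin_le_cond.
- by rewrite sum_push_weight.
Qed.

End Realization.

Lemma collapses_retraction (R : realType) (V : finType) (K L : {set {set V}}) :
  collapses K L -> down_closed K -> finset.set0 \in L ->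
  exists f : 'rV[R]_#|V| -> 'rV[R]_#|V|, [/\ continuous f,
    forall x, realization K x -> realization L (f x) &
    forall x, realization L x -> f x = x].
Proof.
elim=> [{}K|s u {}K {}L us sK usK max KL IH] dK L0.
  by exists id; split=> // x; exact: cvg_id.
have s0 : s != finset.set0.
  apply: contraTneq L0 => s0; apply/negP => /(fintype.subsetP
    (collapses_sub KL)).
  by rewrite !inE s0 eqxx.
have dK' : down_closed (K :\: [set s; u |: s]%SET).
  move=> F G FG; rewrite !inE negb_or => /andP[/andP[nGs nGus] GK].
  rewrite (dK _ _ FG GK) andbT; apply/norP; split.
    apply/negP => /eqP Fs; rewrite Fs in FG.
    by have [e|e] := max _ GK FG; rewrite e eqxx in nGs nGus.
  apply/negP => /eqP Fs; rewrite Fs in FG.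
  have sG := fintype.subset_trans (finset.subsetUr _ _) FG.
  by have [e|e] := max _ GK sG; rewrite e eqxx in nGs nGus.
have [f [fc fK fL]] := IH dK' L0.
exists (f \o push_weight s u); split.
- move=> x; apply: continuous_comp; [exact: push_weight_continuous|exact: fc].
- by move=> x Kx; apply: fK; exact: realization_push_weight.
- move=> x Lx /=; rewrite (@push_weight_id _ _ s u L x) ?fL //.
  apply/negP => ssx; case: Lx => _ _ /(fintype.subsetP (collapses_sub KL)).
  rewrite !inE negb_or => /andP[/andP[nGs nGus] GK].
  by have [e|e] := max _ GK ssx; rewrite e eqxx in nGs nGus.
Qed.

(** * The Poincare-Miranda theorem *)

Section PoincareMiranda.
Local Open Scope classical_set_scope.
Local Open Scope ring_scope.
Variables (R : realType) (n : nat).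
Implicit Types (x z : 'rV[R]_n).

Definition unit_cube : set 'rV[R]_n := fun x => forall i, -1 <= x 0 i <= 1.

Lemma unit_cube_compact : compact unit_cube.
Proof.
exact: (@rV_compact R n (fun=> `[-1, 1]%classic)
  (fun=> @segment_compact _ _ _)).
Qed.

Definition grid_point m (p : {ffun 'I_n -> 'I_m.+2}) : 'rV[R]_n :=
  \row_i (-1 + 2 * (p i)%:R / m.+1%:R).

Lemma grid_point_cube m (p : {ffun 'I_n -> 'I_m.+2}) : unit_cube (grid_point p).
Proof.
move=> i; rewrite mxE.
have m0 : 0 < m.+1%:R :> R by rewrite ltr0n.
have le : 0 <= ((p i)%:R / m.+1%:R : R) <= 1.
  rewrite divr_ge0 ?ler0n // ler_pdivrMr // mul1r ler_nat -ltnS ltn_ord //.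
rewrite -mulrA; move: (_ / _) le => t /andP[t0 t1]; apply/andP; split; lra.
Qed.

Lemma grid_point_close m (p q : {ffun 'I_n -> 'I_m.+2}) e :
  in_cube p [set: 'I_n] q -> 2 / m.+1%:R < e ->
    ball (grid_point p) e (grid_point q).
Proof.
move=> pq lte; have m0 : 0 < m.+1%:R :> R by rewrite ltr0n.
have d0 : 0 < 2 / m.+1%:R :> R by rewrite divr_gt0.
split=> [|i j]; first exact: lt_trans lte.
rewrite ord1 /ball /= !mxE.
have -> : -1 + 2 * (p j)%:R / m.+1%:R - (-1 + 2 * (q j)%:R / m.+1%:R) =
          - ((2 / m.+1%:R) * ((q j)%:R - (p j)%:R)) :> R.
  by move: (m.+1%:R^-1) ((p j)%:R) ((q j)%:R) => a b c; ring.
apply: le_lt_trans lte; rewrite normrN normrM gtr0_norm //.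
rewrite -[leRHS]mulr1 ler_pM2l // -natrB; last by case/andP: (pq j).
rewrite normr_nat lern1; have := pq j; rewrite inE /=; lia.
Qed.

Variable f : 'rV[R]_n -> 'rV[R]_n.
Hypothesis f_cont : {within unit_cube, continuous f}.
Hypothesis f_hi : forall x i, unit_cube x -> x 0 i = 1 -> 0 < f x 0 i.
Hypothesis f_lo : forall x i, unit_cube x -> x 0 i = -1 -> f x 0 i < 0.

Lemma constant_sign_near z i : unit_cube z -> f z 0 i != 0 ->
  exists2 e : R, 0 < e & forall x, unit_cube x -> ball z e x ->
    (0 < f x 0 i) = (0 < f z 0 i).
Proof.
move=> zc fz0; have FF : Filter (within unit_cube
  (nbhs z)) by exact: within_filter.
have fi : (fun x => f x 0 i) @ within unit_cube (nbhs z) --> f z 0 i.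
  have fz : f @ within unit_cube (nbhs z) --> f z.
    by move/subspace_continuousP: f_cont; exact.
  exact: (@cvg_comp _ _ _ f (fun y : 'rV[R]_n =>
    y 0 i) _ _ _ fz (@coord_continuous R 1 n 0 i (f z))).
have : \forall x \near within unit_cube (nbhs z), (0 < f x 0 i) = (0 < f z 0 i).
  have [pos|] := ltP 0 (f z 0 i).
    by apply: (@filterS _ _ FF _ _ _ (cvgr_gt _ fi _ pos)) => x ->.
  rewrite le_eqVlt (negPf fz0) /= => neg.
  apply: (@filterS _ _ FF _ _ _ (cvgr_lt _ fi _ neg)) => x lt.
  by rewrite ltNge ltW.
rewrite near_withinE => /nbhs_ballP[e e0 es]; exists e => // x xc zx.
exact: es zx xc.
Qed.

(** Label a grid point in direction i by the sign of the i-th coordinate of f.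
    The small cubes with a sign change in every direction accumulate at a point
    z, and near z a nonzero coordinate of f z has constant sign. *)
Lemma poincare_miranda : exists2 x, unit_cube x & f x = 0.
Proof.
apply: contrapT => no.
have nz z : unit_cube z -> exists i, f z 0 i != 0.
  move=> zc; apply/existsP; apply: contraT; rewrite negb_exists => /forallP fz.
  case: no; exists z => //; apply/rowP => i; rewrite mxE.
  by apply/eqP; have := fz i; rewrite negbK.
have sign m : exists c : 'rV[R]_n, unit_cube c /\ forall j, exists y y',
    [/\ unit_cube y, unit_cube y',
        forall e, 2 / m.+1%:R < e -> ball c e y /\ ball c e y' &
        (0 < f y 0 j) != (0 < f y' 0 j)].
  have m0 : m.+1%:R != 0 :> R by rewrite pnatr_eq0.
  have [||p [_ ch]] := @cube_sign_change n m.+1 (fun j q =>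
    0 < f (grid_point q) 0 j).
  - move=> i q q0; apply/negbTE; rewrite -leNgt ltW // f_lo //.
      exact: grid_point_cube.
    by rewrite mxE q0 mulr0 mul0r addr0.
  - move=> i q q1; apply: f_hi; first exact: grid_point_cube.
    by rewrite mxE q1 mulfK //; lra.
  exists (grid_point p); split=> [|j]; first exact: grid_point_cube.
  have [q [q' [pq pq' ne]]] := ch j; exists (grid_point q), (grid_point q').
  split=> //; try exact: grid_point_cube.
  by move=> e lte; split; exact: grid_point_close lte.
have [c cP] := choice sign.
have [z [zc cz]] : unit_cube `&` cluster (c @ \oo) !=set0.
  by apply: unit_cube_compact; exists 0%N => // m _; case: (cP m).
have [i fz] := nz z zc; have [e e0 ze] := constant_sign_near zc fz.
have e2 : 0 < e / 2 by rewrite divr_gt0.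
have [N Ne] : exists N, forall m, (N <= m)%N -> 2 / m.+1%:R < e / 2 :> R.
  exists (Num.bound (4 / e)) => m Nm; have m0 : 0 < m.+1%:R :> R by rewrite
    ltr0n.
  rewrite ltr_pdivrMr //.
  have : 4 / e < m.+1%:R.
    apply: lt_le_trans (archi_boundP _) _; first by rewrite divr_ge0 // ltW.
    by rewrite ler_nat ltnW.
  by rewrite ltr_pdivrMr //; lra.
have [_ [[m Nm <-] zm]] : c @` [set m | (N <= m)%N] `&` ball z (e / 2) !=set0.
  apply: cz; last exact: nbhsx_ballx.
  by exists N => // m Nm; exists m.
have [_ /(_ i)[y [y' [yc y'c close]]]] := cP m; case/negP.
have [cy cy'] := close _ (Ne m Nm).
by rewrite !ze // [e]splitr; [exact: ball_triangle cy'|exact: ball_triangle cy].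

Qed.

End PoincareMiranda.

(** * A retract of a simplex is not a sphere *)

Section RadialProjection.
Local Open Scope classical_set_scope.
Local Open Scope ring_scope.
Variables (R : realType) (n : nat).
Implicit Types x y : 'rV[R]_n.

Definition sqnorm x : R := \sum_i x 0 i ^+ 2.

Definition direction x : 'rV[R]_n := (Num.sqrt (sqnorm x))^-1 *: x.

Lemma sqnorm_gt0 x : x != 0 -> 0 < sqnorm x.
Proof.
move=> x0; rewrite lt_def sumr_ge0 ?andbT => [|i _]; last exact: sqr_ge0.
apply: contraNneq x0 => /eqP; rewrite psumr_eq0 => [/allP sx|i _];
  last exact: sqr_ge0.
apply/eqP/rowP => i; rewrite mxE; apply/eqP.
by have := sx i; rewrite mem_index_enum sqrf_eq0 => /(_ isT).
Qed.

Lemma direction_sphere x : x != 0 -> @unit_sphere R n (direction x).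
Proof.
move=> /sqnorm_gt0 sx; rewrite /unit_sphere /direction.
under eq_bigr do rewrite mxE exprMn.
rewrite -mulr_sumr exprVn sqr_sqrtr ?(ltW sx) // mulVf //.
by rewrite gt_eqF.
Qed.

Lemma sqnorm_continuous : continuous sqnorm.
Proof.
rewrite /sqnorm; elim: (index_enum _) => [|i l IH].
  under eq_fun do rewrite big_nil.
  by move=> x; apply: cst_continuous.
under eq_fun do rewrite big_cons.
have c : continuous (fun x : 'rV[R]_n => x 0 i) := @coord_continuous R 1 n 0 i.
move=> x; exact: (cvgD (cvgM (c x) (c x)) (IH x)).
Qed.

Lemma direction_continuous_at x : x != 0 -> {for x, continuous direction}.
Proof.
move=> x0; apply: (@cvg_row R n _ (nbhs x) (nbhs_filter x)) => i; rewrite mxE;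
  under eq_fun do rewrite mxE.
have c : continuous (fun x : 'rV[R]_n => x 0 i) := @coord_continuous R 1 n 0 i.
apply: cvgM; last exact: c.
apply: cvgV; first by rewrite gt_eqF // sqrtr_gt0 sqnorm_gt0.
exact: (@continuous_comp _ _ _ sqnorm (@Num.sqrt R) x
  (@sqnorm_continuous x) (@sqrt_continuous R _)).
Qed.

Lemma direction_cvg_sphere x : x != 0 ->
  direction @ nbhs x --> within (@unit_sphere R n) (nbhs (direction x)).
Proof.
move=> x0 A; rewrite /within /= => nA.
have := direction_continuous_at x0 nA.
have : \forall y \near x, y != 0.
  have := @norm_continuous R 'rV[R]_n x.
  move=> /cvgr_gt /(_ 0); rewrite normr_gt0 => /(_ x0).
  by apply: filterS => y; rewrite normr_gt0.
by apply: filterS2 => y y0; apply; exact: direction_sphere.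
Qed.

Lemma coord_le_norm x i : `|x 0 i| <= `|x|.
Proof.
rewrite [leRHS]/Num.norm /= mx_normrE.
exact: (le_bigmax _ (fun ij : 'I_1 * 'I_n => `|x ij.1 ij.2|) (0, i)).
Qed.

Lemma unit_cube_norm x : unit_cube x -> `|x| <= 1.
Proof.
move=> xc; rewrite [leLHS]/Num.norm /= mx_normrE; apply/bigmax_leP;
  split=> // -[i j] _ /=.
by rewrite ord1 ler_norml.
Qed.

Variables (m : nat) (g : 'rV[R]_n -> 'rV[R]_m) (c : 'rV[R]_m).

(** The extension of g from the sphere to the cube that joins each value to c
    along a segment. The norm is the maximum norm, which is 1 exactly on the
    boundary of the cube. *)
Definition radial_extension x : 'rV[R]_m :=
  `|x| *: g (direction x) + (1 - `|x|) *: c.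

Hypothesis g_cont : {within @unit_sphere R n, continuous g}.
Hypothesis g_bounded : forall y i, @unit_sphere R n y ->
  `|g y 0 i - c 0 i| <= 1.

Lemma radial_extension_continuous : continuous radial_extension.
Proof.
move=> x; have [->|x0] := eqVneq x 0.
  rewrite /continuous_at {2}/radial_extension normr0 scale0r add0r subr0
    scale1r.
  apply: (@cvg_row R m _ (nbhs (0 : 'rV[R]_n)) (nbhs_filter _)) => i.
  apply/cvgrPdist_lt => e e0.
  near=> y; rewrite /radial_extension !mxE.
  have -> : c 0 i - (`|y| * g (direction y) 0 i + (1 - `|y|) * c 0 i) =
            - (`|y| * (g (direction y) 0 i - c 0 i)) by ring.
  have lty : `|y| < e.
    near: y; apply/nbhs_ballP; exists e => //= y.
    by rewrite mx_norm_ball /ball_ /= sub0r normrN.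
  rewrite normrN normrM normr_id; have [->|y0] := eqVneq y 0.
    by rewrite normr0 mul0r.
  apply: le_lt_trans lty; rewrite -[leRHS]mulr1 ler_wpM2l //.
  by apply: g_bounded; exact: direction_sphere.
have gw : g @ within (@unit_sphere R n) (nbhs (direction x)) --> g
  (direction x).
  by move/subspace_continuousP: g_cont; apply; exact: direction_sphere.
have gd : g \o direction @ nbhs x --> g (direction x).
  exact: (@cvg_comp _ _ _ direction g _ _ _ (direction_cvg_sphere x0) gw).
have nc : {for x, continuous (fun y : 'rV[R]_n =>
  `|y|)} := @norm_continuous R _ x.
have t1 : (fun y => `|y| *: g (direction y)) @ nbhs x --> `|x| *: g
  (direction x).
  exact: (cvgZ nc gd).
have t2 : (fun y : 'rV[R]_n => 1 - `|y|) @ nbhs x --> 1 - `|x|.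
  by apply: cvgB nc; exact: cvg_cst.
have t3 : (fun y : 'rV[R]_n => (1 - `|y|) *: c) @ nbhs x --> (1 - `|x|) *: c.
  by apply: cvgZ t2 _; exact: cvg_cst.
exact: (cvgD t1 t3).
Unshelve. all: by end_near. Qed.

Lemma radial_extension_boundary x : `|x| = 1 ->
  radial_extension x = g (direction x).
Proof. by move=> x1; rewrite /radial_extension x1 scale1r subrr scale0r addr0.
  Qed.

End RadialProjection.

Section NotSphere.
Local Open Scope classical_set_scope.
Local Open Scope ring_scope.
Variables (R : realType) (V : finType) (K : {set {set V}}).
Variable retract : 'rV[R]_#|V| -> 'rV[R]_#|V|.
Hypothesis retract_cont : continuous retract.
Hypothesis retract_to : forall x, realization [set: {set V}]%SET x ->
  realization K (retract x).
Hypothesis retract_id : forall x, realization K x -> retract x = x.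

(** F maps the cube to the sphere and is radial on the boundary, so it
    satisfies the sign conditions of the Poincare-Miranda theorem without
    having a zero. *)
Lemma retract_not_sphere (c : 'rV[R]_#|V|) n : realization K c ->
  ~ homeomorphic (@realization R V K) (@unit_sphere R n).
Proof.
move=> Kc [h [g [h_cont g_cont hK gS]]].
have coord01 (x : 'rV[R]_#|V|) i : realization K x -> 0 <= x 0 i <= 1.
  move=> Kx; have [x_ge0 _ _] := Kx; rewrite x_ge0 /= -(enum_valK i).
  exact: realization_le1 Kx.
have g_bounded y i : @unit_sphere R n y -> `|g y 0 i - c 0 i| <= 1.
  move=> /gS[Kg _]; have /andP[g0 g1] := coord01 _ i Kg.
  have /andP[c0 c1] := coord01 _ i Kc; rewrite ler_norml.
  by apply/andP; split; lra.
pose phi := radial_extension g c.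
have phi_cont : continuous phi := radial_extension_continuous g_cont g_bounded.
have phi_simplex x : unit_cube x -> realization [set: {set V}]%SET (phi x).
  move=> /unit_cube_norm x1; have x0 : 0 <= `|x| := normr_ge0 x.
  have [c0 csum _] := Kc.
  have [->|xn0] := eqVneq x 0.
    by rewrite /phi /radial_extension normr0 scale0r add0r subr0 scale1r;
      split; rewrite ?inE.
  have [[g0 gsum _] _] := gS _ (direction_sphere xn0).
  split=> [i||]; last by rewrite inE.
    by rewrite !mxE addr_ge0 // mulr_ge0 // subr_ge0.
  under eq_bigr do rewrite !mxE.
  by rewrite big_split /= -!mulr_sumr gsum csum; ring.
pose F x := h (retract (phi x)).
have F_sphere x : unit_cube x -> @unit_sphere R n (F x).
  by move=> xc; case: (hK _ (retract_to (phi_simplex _ xc))).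
have F_boundary x : unit_cube x -> `|x| = 1 -> x != 0 -> F x = direction x.
  move=> xc x1 xn0; have [Kg hg] := gS _ (direction_sphere xn0).
  by rewrite /F /phi radial_extension_boundary // retract_id.
have F_cont : {within @unit_cube R n, continuous F}.
  apply/subspace_continuousP => x xc.
  have /subspace_continuousP/(_ _ (retract_to (phi_simplex _ xc))) := h_cont.
  apply: cvg_comp => A.
  rewrite /within /= => nA.
  have rc : {for x, continuous (retract \o phi)}.
    by apply: continuous_comp; [exact: phi_cont|exact: retract_cont].
  apply: (@filterS _ _ (nbhs_filter x) _ _ _ (rc _ nA)) => y Ay yc; apply: Ay.
  exact: retract_to (phi_simplex _ yc).
have norm1 (x : 'rV[R]_n) i : unit_cube x -> `|x 0 i| = 1 -> `|x| = 1 /\ x != 0.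
  move=> xc xi; have x1 : `|x| = 1.
    by apply/eqP; rewrite eq_le unit_cube_norm // -xi coord_le_norm.
  by split=> //; rewrite -normr_gt0 x1.
have sq (x : 'rV[R]_n) : x != 0 -> 0 < (Num.sqrt (sqnorm x))^-1.
  by move=> x0; rewrite invr_gt0 sqrtr_gt0 sqnorm_gt0.
have [||x xc Fx0] := poincare_miranda F_cont.
- move=> x i xc xi; have [x1 x0] := norm1 x i xc (etrans (congr1 _ xi)
  (normr1 _)).
  by rewrite F_boundary // mxE xi mulr1 sq.
- move=> x i xc xi; have [|x1 x0] := norm1 x i xc; first by rewrite xi normrN1.
  by rewrite F_boundary // mxE xi mulrN1 oppr_lt0 sq.
have := F_sphere x xc; rewrite Fx0 /unit_sphere big1 => [/eqP|i _].
  by rewrite eq_sym oner_eq0.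
by rewrite mxE expr0n.
Qed.

End NotSphere.

(** * Spherical subword complexes *)

Section SphericalSubwordComplexes.
Variables (W : finGroupType) (S : {set W}) (cox : coxeter_system S).
Variables (r : nat) (Q : r.-tuple W) (QS : {subset Q <= S}) (x : W).
Local Notation D := (subword_complex S Q x).

Lemma initial_full : initial r r = [set: 'I_r]%SET.
Proof. by apply/setP => i; rewrite !inE ltn_ord. Qed.

Lemma prefix_faces_full : prefix_faces S Q r x = subword_faces S Q x.
Proof.
apply/setP => F; apply/prefix_facesP/idP => [[I FI /and3P[_ /eqP eI /eqP cI]]|].
  rewrite inE; apply/existsP; exists I; rewrite FI;
    apply/asboolP/(reducedE cox QS).
  by rewrite -finset.setTD -initial_full.
rewrite inE => /existsP[I /andP[FI /asboolP/(reducedE cox QS)[eI cI]]];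
  exists I => //.
by rewrite /prefix_facet initial_full finset.subsetT finset.setTD eI cI !eqxx.
Qed.

Lemma demazure_collapse : demazure S Q != x -> finset.set0 \in faces D ->
  collapses [set: {set 'I_r}]%SET (faces D).
Proof.
move=> dx D0; have := prefix_faces_collapse cox QS (x := x) (leqnn r).
rewrite prefix_faces_full initial_full powersetT; apply.
  by rewrite /prefix_demazure take_oversize ?size_tuple.
by apply/finset.set0Pn; exists finset.set0.
Qed.

Lemma void_word_demazure : r = 0 -> finset.set0 \in faces D -> demazure S Q = x.
Proof.
move=> r0; rewrite inE => /existsP[I /andP[_ /asboolP/(reducedE cox QS)[<- _]]].
have -> : (~: I)%SET = finset.set0.
  by apply/setP => i; have := leq_trans (ltn_ord i) (eq_leq r0).
by rewrite subprod0 (size0nil (etrans (size_tuple Q) r0)).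
Qed.

Lemma spherical_demazure (R : realType) : spherical R D -> demazure S Q = x.
Proof.
move=> [D0 [n hom]]; apply: contrapT => /eqP dx.
have [r0|r_gt0] := posnP r; first by rewrite
  (void_word_demazure r0 D0) eqxx in dx.
have [f [fc fD fid]] := collapses_retraction R (demazure_collapse dx D0)
  (fun F G _ _ => finset.in_setT F) D0.
pose v0 := enum_rank (Ordinal r_gt0).
pose e : 'rV[R]_#|'I_r| := (\row_i (i == v0)%:R)%R.
have e_simplex : realization [set: {set 'I_r}]%SET e.
  split=> [i||]; last by rewrite inE.
    by rewrite mxE ler0n.
  rewrite (bigD1 v0) //= mxE eqxx big1 ?addr0 // => i /negPf i0.
  by rewrite mxE i0.
exact: (retract_not_sphere fc fD fid (fD _ e_simplex) hom).
Qed.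

Lemma demazure_pseudomanifold :
  demazure S Q = x -> shellable_pseudomanifold D.
Proof.
move=> dx.
have dem J : bruhat S (subprod Q J) x by rewrite -dx;
  exact: subprod_bruhat_demazure.
split.
- move=> F G fF fG; apply/eqP; rewrite -(eqn_add2r (len S x)).
  by rewrite !(card_facet cox QS).
- by move=> F G H j; exact: facet_flip_unique.
- move=> F j fF jF; have [p [pF fG _]] := facet_flip_exists cox QS dem fF jF.
  exists (p |: F :\ j)%SET; split=> //; last exact: finset.subsetUr.
  by apply: contraNneq pF => <-; rewrite !inE eqxx.
- move=> v _; exists (facet_rank v); split.
  + exact: facet_rank_inj.
  + by move=> F G; exact: facet_rank_last.
  + by move=> F G; exact: facet_shelling.
Qed.

End SphericalSubwordComplexes.

Theorem theorem1p3 (R : realType)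
    (W1 : finGroupType) (S1 : {set W1}) (r1 : nat) (Q1 : r1.-tuple W1)
    (pi1 : W1)
    (W2 : finGroupType) (S2 : {set W2}) (r2 : nat) (Q2 : r2.-tuple W2)
    (pi2 : W2)
    (cox1 : coxeter_system S1) (cox2 : coxeter_system S2)
    (Q1S : {subset Q1 <= S1}) (Q2S : {subset Q2 <= S2})
    (sphA : spherical R (subword_complex S1 Q1 pi1))
    (sphB : spherical R (subword_complex S2 Q2 pi2))
    (f : facet (subword_complex S1 Q1 pi1) -> facet (subword_complex S2 Q2 pi2))
    (f_iso : FR_isomorphism f) :
  exists! g : {ffun face (subword_complex S1 Q1 pi1) ->
                    face (subword_complex S2 Q2 pi2)},
    simplicial_isomorphism g /\ extends_facet_map f g.
Proof.
apply: FR_isomorphism_extends f_iso.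
- exact: (demazure_pseudomanifold cox1 Q1S (spherical_demazure cox1 Q1S sphA)).
- exact: (demazure_pseudomanifold cox2 Q2S (spherical_demazure cox2 Q2S sphB)).
Qed.
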